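(* Let $\lambda\ge 2$ be a fixed integer. There exists a constant $C=C(\lambda)>0$ such that the following holds for all sufficiently large real $X$, all sufficiently large integers $T$, all real $\Delta>X^{1/3}$, all strictly increasing sequences $(s_n)_{n\ge1}$ of positive integers, all complex coefficients $(\gamma_n)_{n\ge 1}$ with $|\gamma_n|\le 1$, and all real $L>0$: $$ \sum_{p\in \mathcal{E}}\frac{1}{\tau(p-1)}\max_{(a, p)=1}\Big|\sum_{n\le T}\gamma_n e^{2\pi i a\lambda^{s_n}/p}\Big|^2 \le C \left(X+s_TX^{1/7}\Delta^{-3/7}L+TL^{-7/4}\right)XT, $$ where $\mathcal{E}=\mathcal{E}(\Delta,X)$ is the set of primes $p\le X$ with $p\nmid\lambda$ for which the multiplicative order $t_p$ of $\lambda$ modulo $p$ satisfies $t_p>\Delta$.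
   Context: For a prime $p$ not dividing $\lambda$, $t_p$ denotes the multiplicative order of $\lambda$ modulo $p$. $\tau(n)$ denotes the number of positive integer divisors of $n$, and $(a,p)$ denotes the greatest common divisor; the maximum is over integers $a$ coprime to $p$. The sum over $n\le T$ is over positive integers $n\le T$. The sequences $(s_n)$ and $(\gamma_n)$ may depend on the parameters $X,T,\Delta$; the constant $C$ does not depend on $X,T,\Delta,L$, $(s_n)$ or $(\gamma_n)$. *)

(* Defs.v *)
From HB Require Import structures.
From mathcomp Require Import all_boot all_order all_fingroup all_algebra.
From mathcomp Require Import all_classical all_reals all_analysis.
From mathcomp Require Import cyclic complex ring.

Set Implicit Arguments.
Unset Strict Implicit.
Unset Printing Implicit Defensive.

Import Order.TTheory GRing.Theory Num.Theory.
Import numFieldNormedType.Exports.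

Local Open Scope classical_set_scope.
Local Open Scope complex_scope.
Local Open Scope ring_scope.

(* The order of the class of l in the unit group of the field with p elements.
   Meaningful for p prime and p not dividing l; when l is not a unit modulo p,
   [insubd] falls back on the identity and the value is 1. *)
Definition mul_order (l p : nat) : nat :=
  #[insubd (1%g : {unit 'F_p}) (l%:R : 'F_p)]%g.

Definition tau (n : nat) : nat := size (divisors n).

Definition e2pi (R : realType) (x : R) : R[i] :=
  cos (2 * pi * x) +i* sin (2 * pi * x).

Definition expsum (R : realType) (l : nat) (s : nat -> nat) (gamma : nat -> R[i])
    (T p : nat) (a : int) : R[i] :=
  \sum_(1 <= n < T.+1) gamma n * e2pi (a%:~R * l%:R ^+ s n / p%:R).

(* A supremum over all integers a coprime to p; it is attained (see
   [max_expsum2_attained]), hence a maximum. *)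
Definition max_expsum2 (R : realType) (l : nat) (s : nat -> nat)
    (gamma : nat -> R[i]) (T p : nat) : R :=
  sup [set ComplexField.Normc.normc (expsum l s gamma T p a) ^+ 2
      | a in [set a : int | coprimez a p]].

Definition Eset (R : realType) (l : nat) (Delta X : R) : set nat :=
  [set p | [/\ prime p, p%:R <= X, ~~ (p %| l)%N & Delta < (mul_order l p)%:R]].

Lemma mul_order_dvdn (l p m : nat) : prime p -> ~~ (p %| l)%N ->
  (mul_order l p %| m)%N = (l ^ m == 1 %[mod p])%N.
Proof.
move=> pp pl; rewrite /mul_order order_dvdn -val_eqE FinRing.val_unitX.
rewrite val_insubd unitfE -(dvdn_pcharf (pchar_Fp pp)) pl /=.
by rewrite -natrX -val_eqE /= val_Fp_nat // Fp_cast.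
Qed.

(* So the finitely supported sum over [Eset], which would be 0 on an infinite
   support, is the sum over all of its elements. *)
Lemma finite_Eset (R : realType) (l : nat) (Delta X : R) :
  finite_set (Eset l Delta X).
Proof.
apply: (@sub_finite_set _ _ `I_(Num.truncn X).+1) => // p [pp pX _ _] /=.
by rewrite ltnS truncn_ge_nat // (le_trans _ pX).
Qed.

Lemma e2piDz (R : realType) (x : R) (z : int) : e2pi (x + z%:~R) = e2pi x.
Proof.
have e2piDn (y : R) (n : nat) : e2pi (y + n%:R) = e2pi y.
  have -> : e2pi (y + n%:R) =
      cos (2 * pi * y + (pi *+ 2) *+ n) +i* sin (2 * pi * y + (pi *+ 2) *+ n).
    by rewrite /e2pi; congr (cos _ +i* sin _); ring.
  by rewrite (periodicn (@cosD2pi R)) (periodicn (@sinD2pi R)).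
case: z => n; first exact: e2piDn.
by rewrite NegzE mulrNz -[RHS](e2piDn _ n.+1) -[in RHS](subrK n.+1%:R x) e2piDn.
Qed.

Lemma expsum_modz (R : realType) (l : nat) (s : nat -> nat) (gamma : nat -> R[i])
    (T p : nat) (a : int) : (0 < p)%N ->
  expsum l s gamma T p (a %% p)%Z = expsum l s gamma T p a.
Proof.
move=> p0; apply: eq_bigr => n _; congr (_ * _).
have p0' : p%:R != 0 :> R by rewrite pnatr_eq0 -lt0n.
have aE : a%:~R = (a %/ p)%Z%:~R * p%:R + (a %% p)%Z%:~R :> R.
  by rewrite {1}(divz_eq a p) (@intrD R) (@intrM R) -pmulrn.
rewrite -[in LHS](e2piDz _ ((a %/ p)%Z * (l ^ s n)%:Z)); congr e2pi.
by rewrite aE (@intrM R) -!pmulrn natrX; field.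
Qed.

Lemma max_expsum2_attained (R : realType) (l : nat) (s : nat -> nat)
    (gamma : nat -> R[i]) (T p : nat) : prime p ->
  exists2 a : int, coprimez a p &
    max_expsum2 l s gamma T p =
      ComplexField.Normc.normc (expsum l s gamma T p a) ^+ 2.
Proof.
move=> pp; have p0 := prime_gt0 pp.
pose f (a : int) := ComplexField.Normc.normc (expsum l s gamma T p a) ^+ 2.
have P1 : coprime (Ordinal (prime_gt1 pp)) p by exact: coprime1n.
case: (@arg_maxP _ _ _ (Ordinal (prime_gt1 pp)) (fun i : 'I_p => coprime i p)
  (fun i : 'I_p => f i%:Z) P1) => m cm fm.
exists m%:Z; first by [].
have ub : ubound [set f a | a in [set a : int | coprimez a p]] (f m%:Z).
  move=> _ [a /= ca <-]; rewrite /f -(expsum_modz l s gamma T a p0).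
  have /andP[r0 rp] : 0 <= (a %% p)%Z < p by rewrite modz_ge0 ?ltz_pmod // -lt0n.
  have rE : (a %% p)%Z = `|(a %% p)%Z|%N by rewrite gez0_abs.
  have rp' : (`|(a %% p)%Z| < p)%N by rewrite -ltz_nat -rE.
  have cr : coprime (Ordinal rp') p.
    by move: ca; rewrite /coprimez -gcdz_modl /coprime /gcdz /=.
  by rewrite rE; exact: (fm (Ordinal rp') cr).
have fin : [set f a | a in [set a : int | coprimez a p]] (f m%:Z).
  by exists m%:Z.
apply/eqP; rewrite eq_le; apply/andP; split.
- by apply: ge_sup => //; exists (f m%:Z).
- by apply: ub_le_sup => //; exists (f m%:Z).
Qed.

(* Main.v *)
Require Import Defs.
From HB Require Import structures.
From mathcomp Require Import all_boot all_order all_fingroup all_algebra.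
From mathcomp Require Import all_classical all_reals all_analysis.
From mathcomp Require Import cyclic complex finmap.
From mathcomp Require Import zify ring lra.

(** For a prime p in the range of summation let t be the order of lambda modulo
    p. The function m |-> e(a lambda^m / p) has period t, so it is a combination
    of the characters m |-> e(b m / t), b < t. Substituting m = s_n turns the
    exponential sum into a combination of the values A(b / t), where
    A(x) = sum_n gamma_n e(x s_n) does not depend on p. Collect the b by the
    reduced denominator d of b / t, a divisor of t. Cauchy-Schwarz over d costs
    the number of divisors of t, which is at most tau(p - 1) and is cancelled
    by the weight; Cauchy-Schwarz inside the class of d leaves

      the sum over d dividing t of w_d B_d,
      B_d = the sum of |A(b / d)|^2 over reduced fractions b / d,

    where, by Parseval modulo d, w_d is at most the maximal square of S / h, with
    S running over the sums of x |-> e(c x / p) over the subgroup of order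
    h = t / d of the units modulo p ([periodic_sum_bound]).

    The number w_d is at most 1, and it is small for small d because of the
    bound of Heath-Brown and Konyagin |S| << p^(1/8) h^(5/8)
    ([subgroup_sum_bound]). With t > Delta and y = X^(1/7) Delta^(-3/7) <= 1
    this yields w_d << min(1, y d^(1/2)). At most X / d primes up to X are
    congruent to 1 modulo d, so the whole sum is
    at most X times the sum over d <= X of w_d B_d / d. The large sieve
    ([farey_large_sieve]) bounds the sum of B_d over d <= D by a multiple of
    (D^2 + s_T) T, and summation over the blocks 4^i <= d < 4^(i+1) gives
    << X T (X + s_T y) ([block_large_sieve]). This is the claim when L >= 1. When
    L < 1 the term T L^(-7/4) exceeds T and the trivial estimate T^2 for each
    prime is enough.

    The subgroup bound rests on the additive energy E of the group H of h-th
    roots of unity. Hoelder's inequality gives |S|^8 <= p E^2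
    ([subgroup_sum_energy]), and E << h^(5/2) follows from Stepanov's method:
    for a set V of k values, k^2 <= h, the number N of z with
    z^h = (z - 1)^h in V satisfies N^3 << (h k)^2 ([stepanov_bound]). One
    constructs a nonzero polynomial of degree about h B that vanishes to order A
    at each of these z. When h is so large that Stepanov's method does not
    apply, Parseval alone gives |S|^2 <= p, which is stronger. *)

Set Implicit Arguments.
Unset Strict Implicit.
Unset Printing Implicit Defensive.

Import Order.TTheory GRing.Theory Num.Theory.
Import numFieldNormedType.Exports.

Local Open Scope complex_scope.
Local Open Scope ring_scope.

(** * Sparse polynomials with a root of high multiplicity *)

(** Vandermonde's argument in differential form. The operator X d/dX - e0
    kills the monomial of exponent e0, multiplies every other coefficient by a
    nonzero constant and lowers the order of vanishing at w by at most one, so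
    the exponents can be removed one at a time. *)
Lemma sparse_poly_eq0 (F : fieldType) (P : nat)
    (charP : forall n, (0 < n < P)%N -> n%:R != 0 :> F)
    (w : F) (S : seq nat) (q : {poly F}) :
  w != 0 -> (forall e, e \in S -> e < P)%N -> (forall e, q`_e != 0 -> e \in S) ->
  ('X - w%:P) ^+ size S %| q -> q = 0.
Proof.
move=> w0; elim: S q => [|e0 S IH] q SP qS dvq.
  by apply/polyP => e; rewrite coef0; apply/eqP; apply: contraT => /qS.
(* The root of order size S of q1 allows induction on S. *)
pose q1 := 'X * q^`() - e0%:R *: q.
have q1E e : q1`_e = (e%:R - e0%:R) * q`_e.
  rewrite coefB coefZ coefXM coef_deriv mulrBl.
  case: e => [|e] /=; first by rewrite mul0r.
  by rewrite -[q`_e.+1 *+ _]mulr_natl.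
have q10 : q1 = 0.
  apply: IH => [e eS|e|].
  - by apply: SP; rewrite inE eS orbT.
  - rewrite q1E mulf_eq0 negb_or => /andP[ee0 /qS].
    by rewrite inE => /orP[/eqP ee|//]; rewrite ee subrr eqxx in ee0.
  - have /dvdpP[g qg] := dvq.
    rewrite /q1 qg /= derivM deriv_exp derivXsubC /= mul1r exprS.
    set z := _ ^+ size S; set d := 'X - w%:P.
    rewrite -mul_polyC.
    have -> : 'X * (g^`() * (d * z) + g * (z *+ (size S).+1))
        - (e0%:R)%:P * (g * (d * z)) =
      ('X * (g^`() * d + g *+ (size S).+1) - (e0%:R)%:P * g * d) * z.
      by rewrite -[z *+ _]mulr_natr -[g *+ _]mulr_natr; ring.
    exact: dvdp_mulIr.
have qe0 e : e != e0 -> q`_e = 0.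
  move=> ee0; apply/eqP; apply: contraT => qe.
  have eP := SP _ (qS _ qe); have e0P := SP e0 (mem_head _ _).
  have /eqP := q1E e; rewrite q10 coef0 eq_sym mulf_eq0 (negbTE qe) orbF.
  have [le_e|lt_e] := leqP e e0.
    rewrite -opprB oppr_eq0 -natrB // (negbTE (charP _ _)) // subn_gt0.
    rewrite ltn_neqAle ee0 le_e /=; exact: leq_ltn_trans (leq_subr _ _) e0P.
  rewrite -natrB ?(ltnW lt_e) // (negbTE (charP _ _)) // subn_gt0 lt_e /=.
  exact: leq_ltn_trans (leq_subr _ _) eP.
have qX : q = q`_e0 *: 'X^e0.
  apply/polyP => e; rewrite coefZ coefXn.
  by case: (eqVneq e e0) => [->|/qe0 ->]; rewrite ?mulr1 ?mulr0.
have : root q w.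
  have := dvq; rewrite /= exprS => h.
  rewrite -dvdp_XsubCl; exact: dvdp_trans (dvdp_mulIl _ _) h.
rewrite qX /root !hornerE mulf_eq0 expf_eq0 (negbTE w0) andbF orbF.
by move=> /eqP ->; rewrite scale0r.
Qed.

(** * The auxiliary polynomial of Stepanov's method *)

(** The value at X of a polynomial in three variables X, Y, Z after the
    substitution Y = X^h, Z = (X - 1)^h; r b c is the coefficient of Y^b Z^c.
    On the points where X^h = (X - 1)^h = v only b + c matters. *)
Definition stepanov_poly (F : fieldType) (h B : nat) (r : nat -> nat -> {poly F}) :=
  \sum_(b < B) \sum_(c < B) r b c * ('X ^+ (h * b) * ('X - 1) ^+ (h * c)).

(** Blocks of length at most h placed at the multiples of h do not overlap. *)
Lemma sum_shifted_blocks_eq0 (F : fieldType) (A B h : nat) (r : nat -> {poly F}) :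
  (A <= h)%N -> (forall c, size (r c) <= A)%N ->
  \sum_(c < B) r c * 'X ^+ (h * c) = 0 -> forall c : 'I_B, r c = 0.
Proof.
move=> Ah sr r0 c; apply/polyP => i; rewrite coef0.
have [iA|Ai] := ltnP i A; last by rewrite nth_default // (leq_trans (sr c)).
have := congr1 (fun q : {poly F} => q`_(i + h * c)) r0.
rewrite coef0 coef_sum (bigD1 c) //= coefMXn ltnNge leq_addl /= addnK.
rewrite big1 ?addr0 // => c' c'c; rewrite coefMXn.
have [//|le] := ltnP; rewrite nth_default // (leq_trans (sr c')) //.
have /orP[lt|lt] : (c' < c)%N || (c < c')%N by rewrite -neq_ltn.
  have : (h * c'.+1 <= h * c)%N by rewrite leq_mul2l lt orbT.
  by rewrite mulnSr; lia.
have : (h * c.+1 <= h * c')%N by rewrite leq_mul2l lt orbT.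
by rewrite mulnSr; lia.
Qed.

(** The substitution Y = X^h, Z = (X - 1)^h loses nothing on polynomials
    of small degree. If b is the first index with some r b c nonzero, then X^h
    divides the sum of the r b c (X - 1)^(h c); in the variable X - 1 that is a
    polynomial with at most A B <= h terms and a root of order h at -1, which
    the lemma on sparse polynomials excludes. *)
Lemma stepanov_poly_eq0 (F : fieldType) (P A B h : nat)
    (charP : forall n, (0 < n < P)%N -> n%:R != 0 :> F)
    (r : nat -> nat -> {poly F}) :
  (A <= h)%N -> (A * B <= h)%N -> (h * B <= P)%N ->
  (forall b c, size (r b c) <= A)%N ->
  stepanov_poly h B r = 0 -> forall b c, (b < B)%N -> (c < B)%N -> r b c = 0.
Proof.
move=> Ah ABh hBP sr F0 b c bB cB.
elim/ltn_ind: b bB c cB => b IH bB c cB.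
(* Modulo X^(h (b + 1)) the polynomial is X^(h b) G. *)
pose G := \sum_(c < B) r b c * ('X - 1) ^+ (h * c).
have dvG : 'X ^+ h %| G.
  have : 'X ^+ (h * b) * G = - (\sum_(b' < B | (b < b')%N) 'X ^+ (h * b') *
      \sum_(c < B) r b' c * ('X - 1) ^+ (h * c)).
    apply/eqP; rewrite -addr_eq0 -[X in _ == X]F0 /stepanov_poly; apply/eqP.
    rewrite [RHS](bigID (fun b' : 'I_B => (b < b')%N)) /= addrC; congr (_ + _); last first.
      apply: eq_bigr => b' _; rewrite mulr_sumr; apply: eq_bigr => c' _.
      by rewrite mulrCA.
    rewrite [RHS](bigD1 (Ordinal bB)) /= ?ltnn // [X in _ = _ + X]big1 ?addr0.
      by rewrite mulr_sumr; apply: eq_bigr => c' _; rewrite mulrCA.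
    move=> b' /andP[b'b nb].
    apply: big1 => c' _; rewrite IH ?mul0r //.
    by rewrite ltn_neqAle leqNgt b'b andbT; move: nb; rewrite -val_eqE.
  move=> e; have : 'X ^+ (h * b) * 'X ^+ h %| 'X ^+ (h * b) * G.
    rewrite e dvdpNr; apply: (big_ind (fun y => _ %| y)) => [|x y|b' bb'].
    - exact: dvdp0.
    - exact: dvdp_add.
    rewrite -exprD -mulnSr; apply: dvdp_mulr.
    by apply: dvdp_exp2l; rewrite leq_mul2l bb' orbT.
  by rewrite dvdp_mul2l // expf_neq0 // polyX_eq0.
pose s c := r b c \Po ('X + 1).
have GE : G \Po ('X + 1) = \sum_(c < B) s c * 'X ^+ (h * c).
  rewrite /G linear_sum /=; apply: eq_bigr => c' _.
  rewrite comp_polyM rmorphXn /= comp_polyB comp_polyX comp_polyC; congr (_ * _ ^+ _).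
  by rewrite addrK.
have ss c' : (size (s c') <= A)%N by rewrite size_comp_poly2 // -polyC1 size_XaddC.
have G0 : G \Po ('X + 1) = 0.
  apply: (@sparse_poly_eq0 _ _ charP (-1) [seq (x.1 + h * x.2)%N | x <- 
     [seq (i, c) | i <- iota 0 A, c <- iota 0 B]]).
  - by rewrite oppr_eq0 oner_eq0.
  - move=> e /mapP[x /allpairsP[[i j] [/= iA jB ->]] ->] /=.
    rewrite !mem_iota /= !add0n in iA jB.
    apply: leq_trans hBP; apply: leq_trans (_ : h * j.+1 <= _)%N.
      by rewrite mulnS ltn_add2r (leq_trans iA).
    by rewrite leq_mul2l jB orbT.
  - move=> e; apply: contraNT => eS; rewrite GE coef_sum big1 // => c' _.
    rewrite coefMXn; case: ltnP => // le; rewrite nth_default //.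
    rewrite (leq_trans (ss c')) // leqNgt; apply: contra eS => lt.
    apply/mapP; exists ((e - h * c')%N, nat_of_ord c'); last by rewrite /= subnK.
    by apply/allpairsP; exists ((e - h * c')%N, nat_of_ord c'); rewrite !mem_iota /= lt ltn_ord.
  - rewrite size_map size_allpairs !size_iota.
    have -> : 'X - (-1)%:P = ('X + 1) :> {poly F} by rewrite polyCN opprK.
    apply: dvdp_trans (dvdp_exp2l _ ABh) _.
    have /dvdpP[g ->] := dvG; rewrite comp_polyM rmorphXn /= comp_polyX.
    exact: dvdp_mulIr.
have := @sum_shifted_blocks_eq0 _ A B h s Ah ss; rewrite -GE G0 => /(_ erefl (Ordinal cB)) /= sc0.
have := size_comp_poly2 (r b c) (q := 'X + 1).
rewrite -/(s c) sc0 -polyC1 size_XaddC size_poly0 => /(_ erefl)/esym/eqP.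
by rewrite size_poly_eq0 => /eqP.
Qed.

(** This derivation replaces d/dX because it acts on r X^u (X - 1)^v through
    r alone, and at points other than 0 and 1 it sees the same orders of
    vanishing. *)
Definition euler01 (F : fieldType) (f : {poly F}) : {poly F} :=
  'X * ('X - 1) * f^`().

Definition twisted_euler01 (F : fieldType) (u v : nat) (r : {poly F}) : {poly F} :=
  'X * ('X - 1) * r^`() + u%:R *: (('X - 1) * r) + v%:R *: ('X * r).

Lemma euler01_twist (F : fieldType) (u v : nat) (r : {poly F}) :
  euler01 (r * ('X ^+ u * ('X - 1) ^+ v)) =
  twisted_euler01 u v r * ('X ^+ u * ('X - 1) ^+ v).
Proof.
rewrite /euler01 /twisted_euler01 !derivM !deriv_exp derivX derivB derivX derivC subr0 !mul1r.
have XE (q : {poly F}) n : q * (q ^+ n.-1 *+ n) = n%:R *: q ^+ n.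
  by case: n => [|n]; rewrite ?mulr0n ?mulr0 ?scale0r //= mulrnAr -exprS scaler_nat.
have XuE := XE 'X u; have XvE := XE ('X - 1) v.
rewrite -!mul_polyC in XuE XvE *.
move: ('X ^+ u) ('X ^+ u.-1 *+ u) (('X - 1) ^+ v) (('X - 1) ^+ v.-1 *+ v) XuE XvE => a a' b b' ea eb.
transitivity ('X * ('X - 1) * (r^`() * (a * b)) + r * (('X - 1) * ('X * a') * b + 'X * (('X - 1) * b') * a)); first by ring.
by rewrite ea eb; ring.
Qed.

Lemma iter_euler01_twist (F : fieldType) (u v m : nat) (r : {poly F}) :
  iter m (@euler01 F) (r * ('X ^+ u * ('X - 1) ^+ v)) =
  iter m (twisted_euler01 u v) r * ('X ^+ u * ('X - 1) ^+ v).
Proof. by elim: m => //= m ->; rewrite euler01_twist. Qed.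

(** The degree grows by at most one per application; this keeps the number
    of linear conditions at each value v at most A + m for the m-th iterate. *)
Lemma size_twisted_euler01 (F : fieldType) (u v : nat) (r : {poly F}) :
  (size (twisted_euler01 u v r) <= (size r).+1)%N.
Proof.
have X1 : size ('X - 1 : {poly F}) = 2 by rewrite -polyC1 size_XsubC.
have sX : (size ('X * r)%R <= (size r).+1)%N.
  by apply: leq_trans (size_polyMleq _ _) _; rewrite size_polyX.
have sX1 : (size (('X - 1) * r)%R <= (size r).+1)%N.
  by apply: leq_trans (size_polyMleq _ _) _; rewrite X1.
rewrite /twisted_euler01.
apply: leq_trans (size_polyD _ _) _; rewrite geq_max (leq_trans (size_scale_leq _ _) sX) andbT.
apply: leq_trans (size_polyD _ _) _; rewrite geq_max (leq_trans (size_scale_leq _ _) sX1) andbT.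
have [->|r0] := eqVneq r 0; first by rewrite deriv0 mulr0 size_poly0.
have := lt_size_deriv r0.
have [->|r'0] := eqVneq r^`() 0; first by rewrite mulr0 size_poly0.
move=> lt; apply: leq_trans (size_polyMleq _ _) _.
have sXX : (size ('X * ('X - 1) : {poly F})%R <= 3)%N.
  by apply: leq_trans (size_polyMleq _ _) _; rewrite size_polyX X1.
move: (size _) (size _) (size _) sXX lt => a b c; lia.
Qed.

Lemma size_iter_twisted_euler01 (F : fieldType) (u v m : nat) (r : {poly F}) :
  (size (iter m (twisted_euler01 u v) r) <= size r + m)%N.
Proof.
elim: m => [|m IH] /=; first by rewrite addn0.
by apply: leq_trans (size_twisted_euler01 _ _ _) _; rewrite addnS ltnS.
Qed.

Lemma twisted_euler01_linear (F : fieldType) (u v : nat) :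
  linear (@twisted_euler01 F u v).
Proof.
move=> k x y; rewrite /twisted_euler01 derivD derivZ -!mul_polyC; ring.
Qed.

Lemma iter_twisted_euler01_linear (F : fieldType) (u v m : nat) :
  linear (iter m (@twisted_euler01 F u v)).
Proof. by elim: m => // m IH k x y /=; rewrite IH twisted_euler01_linear. Qed.

Lemma euler01_linear (F : fieldType) : linear (@euler01 F).
Proof. by move=> k x y; rewrite /euler01 derivD derivZ -!mul_polyC; ring. Qed.

HB.instance Definition _ (F : fieldType) (u v m : nat) := GRing.isLinear.Build F {poly F} {poly F} _
  (iter m (@twisted_euler01 F u v)) (@iter_twisted_euler01_linear F u v m).
HB.instance Definition _ (F : fieldType) := GRing.isLinear.Build F {poly F} {poly F} _
  (@euler01 F) (@euler01_linear F).

Lemma iter_euler01_stepanov (F : fieldType) (h B m : nat) (r : nat -> nat -> {poly F}) :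
  iter m (@euler01 F) (stepanov_poly h B r) =
  stepanov_poly h B (fun b c => iter m (twisted_euler01 (h * b) (h * c)) (r b c)).
Proof.
rewrite /stepanov_poly.
under [RHS]eq_bigr do under eq_bigr do rewrite -iter_euler01_twist.
elim: m => //= m ->; rewrite linear_sum; apply: eq_bigr => b _.
by rewrite linear_sum.
Qed.

(** In characteristic at least P an order of vanishing mu with 0 < mu < P
    drops by exactly one under the derivation at a point other than 0 and 1. *)
Lemma dvdp_exp_of_euler01 (F : fieldType) (P D : nat)
    (charP : forall n, (0 < n < P)%N -> n%:R != 0 :> F) (z : F) (f : {poly F}) :
  z != 0 -> z != 1 -> (D <= P)%N ->
  (forall m, (m < D)%N -> root (iter m (@euler01 F) f) z) ->
  ('X - z%:P) ^+ D %| f.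
Proof.
move=> z0 z1; elim: D f => [|D IH] f DP fz; first by rewrite expr0 dvd1p.
have dv : ('X - z%:P) ^+ D %| euler01 f.
  by apply: IH => [|m mD]; [exact: ltnW|rewrite -iterSr fz].
have [->|f0] := eqVneq f 0; first exact: dvdp0.
have [m [g]] := multiplicity_XsubC f z.
rewrite f0 /= => gz fE; have [Dm|mD] := ltnP D m.
  by rewrite fE dvdp_mull // dvdp_exp2l.
have m0 : (0 < m)%N.
  case: m fE {mD} => // fE; have := fz 0 (ltn0Sn _).
  by rewrite /= fE expr0 mulr1 (negbTE gz).
have := dv; rewrite /euler01 fE derivM deriv_exp derivXsubC mul1r.
have dvm : ('X - z%:P) ^+ m %| ('X - z%:P) ^+ D by exact: dvdp_exp2l.
move=> /(dvdp_trans dvm).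
case: m m0 mD fE {dvm} => // m _ mD fE /=.
rewrite exprS; set d := _ ^+ m; set l := 'X - z%:P.
have -> : 'X * ('X - 1) * (g^`() * (l * d) + g * (d *+ m.+1)) =
    ('X * ('X - 1) * (g^`() * l + g *+ m.+1)) * d.
  by rewrite -[d *+ _]mulr_natr -[g *+ _]mulr_natr; ring.
rewrite dvdp_mul2r ?expf_neq0 ?polyXsubC_eq0 // dvdp_XsubCl /root !hornerE subrr mulr0 add0r.
rewrite !mulf_eq0 (negbTE z0) subr_eq0 (negbTE z1) /= hornerMn -mulr_natr mulf_eq0.
rewrite -/(root g z) (negbTE gz) (negbTE (charP _ _)) //=.
by rewrite (leq_ltn_trans mD).
Qed.

Lemma size_roots_mult (F : fieldType) (D : nat) (f : {poly F}) (s : seq F) :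
  f != 0 -> uniq s -> (forall z, z \in s -> ('X - z%:P) ^+ D %| f) ->
  (size s * D < size f)%N.
Proof.
move=> f0 us dv; pose g := \prod_(z <- s) ('X - z%:P) ^+ D.
have : g %| f.
  rewrite /g; elim: s us dv {g} => [|z s IH] /=; first by rewrite big_nil dvd1p.
  move=> /andP[zs us] dv; rewrite big_cons Gauss_dvdp.
    by rewrite dv ?mem_head //= IH // => w ws; apply: dv; rewrite inE ws orbT.
  rewrite coprimep_expl // big_seq; apply: (big_ind (coprimep ('X - z%:P))) => [|p q|w ws].
  - exact: coprimep1.
  - by rewrite coprimepMr => -> ->.
  apply: coprimep_expr; rewrite coprimep_XsubC root_XsubC.
  by apply: contraNneq zs => <-.
move=> /dvdp_leq => /(_ f0); apply: leq_trans.
have g0 : g != 0 by rewrite prodf_seq_neq0; apply/allP => z _; rewrite expf_neq0 ?polyXsubC_eq0.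
rewrite -[size g]prednK ?size_poly_gt0 // ltnS.
by rewrite /g prodrXl size_exp size_prod_XsubC.
Qed.

(** More unknowns than equations: the matrix of the system has a
    nontrivial left kernel. *)
Lemma underdetermined_system (F : fieldType) (I J : finType) (M : I -> J -> F) :
  (#|J| < #|I|)%N ->
  exists2 c : I -> F, (exists i, c i != 0) & forall j, \sum_i c i * M i j = 0.
Proof.
move=> JI; pose N := \matrix_(i < #|I|, j < #|J|) M (enum_val i) (enum_val j).
have : kermx N != 0.
  rewrite kermx_eq0 /row_free neq_ltn (leq_ltn_trans (rank_leq_col N)) //.
case/rowV0Pn => v /sub_kermxP vN /rV0Pn[i0 vi0].
exists (fun i => v 0 (enum_rank i)); first by exists (enum_val i0); rewrite enum_valK.
move=> j; have := congr1 (fun w : 'rV_#|J| => w 0 (enum_rank j)) vN.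
rewrite !mxE => vNj; rewrite -[RHS]vNj [RHS](reindex_onto (@enum_rank I) (@enum_val I (mem I))) /=.
  apply: eq_big => [i|i _]; first by rewrite /= enum_rankK eqxx.
  by rewrite mxE !enum_rankK.
by move=> i _; rewrite enum_valK.
Qed.

Lemma poly_eq0_of_coef (F : fieldType) (n : nat) (r : {poly F}) :
  (size r <= n)%N -> (forall i : 'I_n, r`_i = 0) -> r = 0.
Proof.
move=> sr r0; apply/polyP => i; rewrite coef0.
have [lt|le] := ltnP i n; first exact: (r0 (Ordinal lt)).
by rewrite nth_default // (leq_trans sr).
Qed.

(** The A B^2 coefficients of the auxiliary polynomial are unknowns. At a
    point z with z^h = (z - 1)^h = v the m-th iterate of euler01 takes the value at z of a
    polynomial of degree below A + m that depends only on v, so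
    requiring this polynomial to vanish, for all v in V and m < A, takes at
    most 2 |V| A^2 linear equations, and this settles every such z at once.
    A nonzero solution vanishes to order A at all these points, and its degree
    is below 2 h B. *)
Lemma stepanov_count (F : finFieldType) (P A B h : nat) (V : {set F})
    (charP : forall n, (0 < n < P)%N -> n%:R != 0 :> F) :
  (0 < A)%N -> (A * B <= h)%N -> (h * B <= P)%N -> (2 * #|V| * A < B ^ 2)%N ->
  0 \notin V ->
  (#|[set z : F | (z ^+ h == (z - 1) ^+ h) && (z ^+ h \in V)]| * A <= 2 * h * B)%N.
Proof.
move=> A0 ABh hBP kAB V0.
have B0 : (0 < B)%N by case: B kAB {ABh hBP} => //; rewrite expnS ltn0.
have Ah : (A <= h)%N by apply: leq_trans ABh; rewrite leq_pmulr.
have h0 : (0 < h)%N by apply: leq_trans Ah.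
pose I := ('I_B * 'I_B * 'I_A)%type.
pose J := ('I_A * {x : F | x \in V} * 'I_(A + A))%type.
pose M (i : I) (j : J) : F :=
  (iter j.1.1 (twisted_euler01 (h * i.1.1) (h * i.1.2)) ('X ^+ i.2))`_j.2
  * val j.1.2 ^+ (i.1.1 + i.1.2).
have [|c [[[b0 c0] a0] nz] cM] := @underdetermined_system F I J M.
  rewrite !card_prod !card_ord card_sig.
  have -> : #|[pred x | x \in V]| = #|V| by apply: eq_card => x.
  rewrite mulnC addnn -mul2n mulnA; nia.
pose r b c' := \sum_(a < A) (if insub b is Some b' then if insub c' is Some c'' then c (b', c'', a) else 0 else 0) *: 'X ^+ a : {poly F}.
have rE (b c' : 'I_B) : r b c' = \sum_(a < A) c (b, c', a) *: 'X ^+ a.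
  by rewrite /r !valK.
have sr b c' : (size (r b c') <= A)%N.
  rewrite /r; apply: leq_trans (size_sum _ _ _) _; apply/bigmax_leqP => a _.
  by apply: leq_trans (size_scale_leq _ _) _; rewrite size_polyXn.
have F0 : stepanov_poly h B r != 0.
  apply: contra nz => /eqP F0; apply/eqP.
  have := stepanov_poly_eq0 charP Ah ABh hBP sr F0 (ltn_ord b0) (ltn_ord c0).
  rewrite rE => /(congr1 (fun q : {poly F} => q`_a0)).
  rewrite coef0 coef_sum (bigD1 a0) //= coefZ coefXn eqxx mulr1 big1 ?addr0 // => a aa0.
  by rewrite coefZ coefXn eq_sym val_eqE (negbTE aa0) mulr0.
set Z := [set z | _].
have : (size (enum Z) * A < size (stepanov_poly h B r))%N.
  apply: size_roots_mult => // [|z]; first exact: enum_uniq.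
  rewrite mem_enum inE => /andP[/eqP z1h zV].
  have zh0 : z ^+ h != 0 by apply: contraNneq V0 => <-.
  have z0 : z != 0 by apply: contraNneq zh0 => ->; rewrite expr0n eqn0Ngt h0.
  have z1 : z != 1.
    by apply: contraNneq zh0 => z1; rewrite z1h z1 subrr expr0n eqn0Ngt h0.
  apply: (dvdp_exp_of_euler01 charP) => // [|m mA].
    by apply: leq_trans hBP; rewrite (leq_trans Ah) // leq_pmulr.
  rewrite iter_euler01_stepanov /root; apply/eqP.
  have : \sum_(b < B) \sum_(c' < B)
      (z ^+ h) ^+ (b + c') *: iter m (twisted_euler01 (h * b) (h * c')) (r b c') = 0.
    apply: (@poly_eq0_of_coef _ (A + A)) => [|i].
      apply: leq_trans (size_sum _ _ _) _; apply/bigmax_leqP => b _.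
      apply: leq_trans (size_sum _ _ _) _; apply/bigmax_leqP => c' _.
      apply: leq_trans (size_scale_leq _ _) _.
      apply: leq_trans (size_iter_twisted_euler01 _ _ _ _) _.
      by apply: leq_add; rewrite ?sr // ltnW.
    have zVj := cM (Ordinal mA, Sub (z ^+ h) zV, i).
    rewrite -[RHS]zVj; set j0 := (_, _, i).
    transitivity (\sum_b \sum_c' \sum_a c (b, c', a) * M (b, c', a) j0); last first.
      by rewrite !pair_bigA; apply: eq_bigr => -[[b c'] a].
    rewrite coef_sum; apply: eq_bigr => b _; rewrite coef_sum; apply: eq_bigr => c' _.
    rewrite coefZ rE linear_sum coef_sum mulr_sumr; apply: eq_bigr => a _.
    by rewrite linearZ coefZ /M /= mulrCA [in RHS](mulrC _`_i).
  move=> /(congr1 (fun q : {poly F} => q.[z])); rewrite horner0 => <-.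
  rewrite /stepanov_poly !horner_sum; apply: eq_bigr => b _.
  rewrite !horner_sum; apply: eq_bigr => c' _.
  by rewrite !hornerE !exprM -z1h mulrC exprD mulrA.
move=> lt; rewrite cardE.
have : (size (stepanov_poly h B r) <= 2 * h * B)%N.
  apply: leq_trans (size_sum _ _ _) _; apply/bigmax_leqP => b _.
  apply: leq_trans (size_sum _ _ _) _; apply/bigmax_leqP => c' _.
  apply: leq_trans (size_polyMleq _ _) _.
  have := size_polyMleq ('X ^+ (h * b) : {poly F}) (('X - 1) ^+ (h * c')).
  rewrite size_polyXn -polyC1 size_exp_XsubC => s1.
  have bB := ltn_ord b; have cB := ltn_ord c'; have := sr b c'.
  have : (h * b.+1 <= h * B)%N by rewrite leq_mul2l bB orbT.
  have : (h * c'.+1 <= h * B)%N by rewrite leq_mul2l cB orbT.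
  rewrite !mulnS. move: (size _) (size _) s1 => x y; lia.
by move/(leq_trans lt)/ltnW.
Qed.

(** * Additive energy of a multiplicative subgroup *)

Lemma exists_sqrtn (n : nat) : exists s, (s ^ 2 <= n < s.+1 ^ 2)%N.
Proof.
elim: n => [|n [s /andP[sn ns]]]; first by exists 0%N.
have [le|lt] := leqP (s.+1 ^ 2) n.+1; last by exists s; rewrite lt leqW.
exists s.+1; rewrite le /=; apply: leq_ltn_trans ns _.
by rewrite ltn_exp2r.
Qed.

Lemma exists_subset_card (T : finType) (V : {set T}) (s : nat) :
  (s <= #|V|)%N -> exists2 W : {set T}, W \subset V & #|W| = s.
Proof.
move=> sV; exists [set x in take s (enum V)].
  by apply/fintype.subsetP => x; rewrite inE => /mem_take; rewrite mem_enum.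
by rewrite cardsE (card_uniqP _) ?take_uniq ?enum_uniq // size_takel // -cardE.
Qed.

(** A is of size (h^2 / k)^(1/3) and B of size (k A)^(1/2): A is the largest
    value that keeps A B <= h, and B the smallest for which there are more
    unknowns than equations. *)
Lemma stepanov_parameters (h k P : nat) :
  (0 < k)%N -> (k ^ 2 <= h)%N -> (4 * h ^ 3 <= P ^ 2)%N -> (4 <= h)%N ->
  exists A B, [/\ (0 < A)%N, (A * B <= h)%N, (h * B <= P)%N,
    (2 * k * A < B ^ 2)%N & (B ^ 2 <= 8 * k * A)%N /\ (h ^ 2 <= 64 * k * A ^ 3)%N].
Proof.
move=> k0 kh hP h4.
have k8 : (8 * k <= h ^ 2)%N.
  have : (64 * k ^ 2 <= h ^ 4)%N.
    apply: leq_trans (_ : 64 * h <= _)%N; first by rewrite leq_mul2l kh orbT.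
    have h3 : (64 <= h ^ 3)%N by rewrite -[64%N]/(4 ^ 3)%N leq_exp2r.
    by rewrite (expnSr h 3) leq_mul2r h3 orbT.
  by move=> le; rewrite -(leq_exp2r _ _ (e := 2)) // expnMn -expnM.
(* With B^2 <= 8 k A, the condition p A gives (A B)^2 <= h^2. *)
pose p A := (8 * k * A ^ 3 <= h ^ 2)%N.
have [|A A_h|A pA maxA] := @ex_maxnP p (h ^ 2); first by exists 1%N; rewrite /p exp1n muln1.
  apply: leq_trans A_h; apply: leq_trans (_ : 1 * A ^ 3 <= _)%N; last by rewrite leq_mul2r; nia.
  by rewrite mul1n; case: A => // A; rewrite -{1}(expn1 A.+1) leq_pexp2l.
have A0 : (0 < A)%N by apply: maxA; rewrite /p exp1n muln1.
have {}pA : (8 * k * A ^ 3 <= h ^ 2)%N := pA.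
have [|B qB minB] := @ex_minnP (fun B => 2 * k * A < B ^ 2)%N.
  by exists (2 * k * A).+1; rewrite -{1}(expn1 (2 * k * A).+1) leq_pexp2l.
have hA : (h ^ 2 <= 64 * k * A ^ 3)%N.
  have : ~~ p A.+1 by apply/negP => /maxA; rewrite ltnn.
  rewrite /p -ltnNge => /ltnW lt; apply: leq_trans lt _.
  have : (A.+1 ^ 3 <= (2 * A) ^ 3)%N by rewrite leq_exp2r //; lia.
  by rewrite expnMn => le; nia.
have BA : (B ^ 2 <= 8 * k * A)%N.
  case: B qB minB => // B qB minB.
  have : (B ^ 2 <= 2 * k * A)%N.
    by rewrite leqNgt; apply/negP => /minB; rewrite ltnn.
  have [->|B0] := posnP B; first by nia.
  have : (B.+1 ^ 2 <= (2 * B) ^ 2)%N by rewrite leq_exp2r //; lia.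
  by rewrite expnMn; nia.
exists A, B; split=> //.
  rewrite -(leq_exp2r _ _ (e := 2)) // expnMn.
  apply: leq_trans (_ : A ^ 2 * (8 * k * A) <= _)%N; first by rewrite leq_mul2l BA orbT.
  apply: leq_trans pA; rewrite (expnS A 2); nia.
have B4h : (B ^ 2 <= 4 * h)%N.
  rewrite -(leq_exp2r _ _ (e := 3)) //.
  apply: leq_trans (_ : (8 * k * A) ^ 3 <= _)%N; first by rewrite leq_exp2r.
  apply: leq_trans (_ : 64 * k ^ 2 * h ^ 2 <= _)%N.
    have -> : ((8 * k * A) ^ 3 = 64 * k ^ 2 * (8 * k * A ^ 3))%N by rewrite !expnMn; ring.
    by rewrite leq_mul2l pA orbT.
  have -> : ((4 * h) ^ 3 = 64 * h * h ^ 2)%N by rewrite expnMn; ring.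
  by rewrite leq_mul2r leq_mul2l kh !orbT.
rewrite -(leq_exp2r _ _ (e := 2)) // expnMn; apply: leq_trans hP.
by rewrite (expnSr h 2) mulnCA leq_mul2l B4h orbT.
Qed.

Lemma stepanov_bound (F : finFieldType) (P h : nat) (V : {set F})
    (charP : forall n, (0 < n < P)%N -> n%:R != 0 :> F) :
  (#|V| ^ 2 <= h)%N -> (4 * h ^ 3 <= P ^ 2)%N -> (4 <= h)%N -> 0 \notin V ->
  (#|[set z : F | (z ^+ h == (z - 1) ^+ h) && (z ^+ h \in V)]| ^ 3
     <= 2 ^ 11 * h ^ 2 * #|V| ^ 2)%N.
Proof.
move=> kh hP h4 V0; have [V00|k0] := posnP #|V|.
  have -> : V = finset.set0 by apply/eqP; rewrite -cards_eq0 V00.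
  rewrite (_ : [set z | _] = finset.set0) ?cards0 //.
  by apply/setP => z; rewrite !inE andbF.
have [A [B [A0 ABh hBP kAB [BA hA]]]] := stepanov_parameters k0 kh hP h4.
have := stepanov_count charP A0 ABh hBP kAB V0.
set N := #|_|; set k := #|V| in k0 kh kAB BA hA *.
move=> NA.
have N2A : (N ^ 2 * A <= 32 * h ^ 2 * k)%N.
  have : (N ^ 2 * A ^ 2 <= 4 * h ^ 2 * B ^ 2)%N.
    by rewrite -!expnMn -[4%N]/(2 ^ 2)%N -!expnMn leq_exp2r.
  move=> le; rewrite -(leq_pmul2r A0).
  apply: leq_trans (_ : N ^ 2 * A ^ 2 <= _)%N; first by rewrite -mulnA.
  apply: leq_trans le _; apply: leq_trans (_ : 4 * h ^ 2 * (8 * k * A) <= _)%N.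
    by rewrite leq_mul2l BA orbT.
  by rewrite leq_eqVlt; apply/orP; left; apply/eqP; ring.
have h20 : (0 < h ^ 2)%N by rewrite expn_gt0; lia.
have : (N ^ 6 <= 2 ^ 21 * h ^ 4 * k ^ 4)%N.
  rewrite -(leq_pmul2r h20); apply: leq_trans (_ : N ^ 6 * (64 * k * A ^ 3) <= _)%N.
    by rewrite leq_mul2l hA orbT.
  have -> : (N ^ 6 * (64 * k * A ^ 3) = 64 * k * (N ^ 2 * A) ^ 3)%N by rewrite expnMn -expnM; ring.
  apply: leq_trans (_ : 64 * k * (32 * h ^ 2 * k) ^ 3 <= _)%N.
    by rewrite leq_mul2l leq_exp2r // N2A orbT.
  by rewrite leq_eqVlt; apply/orP; left; apply/eqP; rewrite -[32%N]/(2 ^ 5)%N -[64%N]/(2 ^ 6)%N (expnMn (2 ^ 5 * h ^ 2)) (expnMn (2 ^ 5)) -!expnM; ring.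
move=> le; rewrite -(leq_exp2r _ _ (e := 2)) // (expnMn (2 ^ 11 * h ^ 2)) (expnMn (2 ^ 11)) -!expnM.
apply: leq_trans le _; rewrite leq_mul2r leq_mul2r.
by apply/orP; right; apply/orP; right; rewrite leq_exp2l.
Qed.

(** The number of representations of u as a difference of two h-th roots of
    unity; the sum of its squares is the additive energy of that group. *)
Definition diffs (F : finFieldType) (h : nat) (u : F) : nat :=
  #|[set x : F | (x ^+ h == 1) && ((x - u) ^+ h == 1)]|.

Lemma card_unity_roots (F : finFieldType) (h : nat) (c : F) : (0 < h)%N ->
  (#|[set x : F | x ^+ h == c]| <= h)%N.
Proof.
move=> h0; rewrite cardE -ltnS -(size_XnsubC c h0); apply: max_poly_roots.
- by rewrite -size_poly_eq0 size_XnsubC.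
- by apply/allP => x; rewrite mem_enum inE rootE !hornerE => /eqP ->; rewrite subrr.
- exact: enum_uniq.
Qed.

(** If u = x - x' with x and x' h-th roots of unity, then z = x / u has
    z^h = (z - 1)^h = u^(-h), so a popular u gives many points z over the value
    u^(-h), and Stepanov's bound limits the number of such values. It applies to
    at most sqrt h values; a larger family contains a subfamily with about
    sqrt h values, and this contradicts the lower bound on t. *)
Lemma card_popular_diffs (F : finFieldType) (P h t : nat)
    (charP : forall n, (0 < n < P)%N -> n%:R != 0 :> F) :
  (4 * h ^ 3 <= P ^ 2)%N -> (4 <= h)%N -> (256 * h < t ^ 2)%N ->
  (#|[set u : F | (u != 0%R) && (t <= diffs h u)]| * t ^ 3 <= 2 ^ 11 * h ^ 3)%N.
Proof.
move=> hP h4 th; set U := [set u | _].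
have h0 : (0 < h)%N by apply: leq_trans h4.
have t0 : (0 < t)%N by case: t th {U} => //; rewrite expnS.
pose V := [set u ^- h | u in U].
have V0 : 0 \notin V.
  apply/imsetP => -[u]; rewrite inE => /andP[u0 _] /esym/eqP.
  by rewrite invr_eq0 expf_eq0 (negbTE u0) andbF.
have UV : (#|U| <= h * #|V|)%N.
  rewrite -sum1_card (partition_big (fun u => u ^- h) (mem V)) /=; last first.
    by move=> u uU; apply: imset_f.
  rewrite mulnC -sum_nat_const; apply: leq_sum => a _.
  apply: leq_trans (card_unity_roots (a^-1) h0); rewrite sum1_card subset_leq_card //.
  by apply/fintype.subsetP => u; rewrite !inE => /andP[_ /eqP <-]; rewrite invrK.
have key (W : {set F}) : W \subset V -> (#|W| ^ 2 <= h)%N ->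
    (#|W| * t ^ 3 <= 2 ^ 11 * h ^ 2)%N.
  move=> WV Wh; have [->//|W0] := posnP #|W|.
  have := stepanov_bound charP Wh hP h4; set Z := [set z | _].
  move=> /(_ (contra (fintype.subsetP WV 0) V0)) leZ.
  have : (#|W| * t <= #|Z|)%N.
    rewrite -[#|Z|]sum1_card (partition_big (fun z => z ^+ h) (mem W)) /=; last first.
      by move=> z; rewrite inE => /andP[].
    rewrite -sum_nat_const; apply: leq_sum => a aW.
    have /imsetP[u + ua] := fintype.subsetP WV _ aW.
    rewrite inE => /andP[u0 /leq_trans]; apply.
    rewrite /diffs sum1_card -(card_imset _ (mulIf (invr_neq0 u0))) subset_leq_card //.
    apply/fintype.subsetP => _ /imsetP[x /[!inE] /andP[/eqP xh /eqP xuh] ->].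
    have e1 : (x / u) ^+ h = a by rewrite expr_div_n xh div1r ua.
    have e2 : (x / u - 1) ^+ h = a.
      by rewrite -[X in _ - X](divff u0) -mulrBl expr_div_n xuh div1r ua.
    by rewrite unfold_in /= !inE e1 e2 aW !eqxx.
  rewrite -(leq_exp2r _ _ (e := 3)) // => /leq_trans/(_ leZ).
  rewrite expnMn (expnSr #|W| 2) [leqRHS]mulnC -mulnA leq_pmul2l ?expn_gt0 ?W0 //.
suff : (#|V| ^ 2 <= h)%N.
  move=> /(key V (fintype.subxx _)) le; apply: leq_trans (_ : h * #|V| * t ^ 3 <= _)%N.
    by rewrite leq_mul2r UV orbT.
  by rewrite -mulnA (expnS h 2) [leqRHS]mulnCA leq_mul2l le orbT.
rewrite leqNgt; apply/negP => hV.
(* V has more than sqrt h elements: pass to a subset with s = floor (sqrt h). *)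
have [s /andP[sh hs]] := exists_sqrtn h.
have sV : (s <= #|V|)%N by rewrite -(leq_exp2r _ _ (e := 2)) // (leq_trans sh) // ltnW.
have [W WV Ws] := exists_subset_card sV.
have := key W WV; rewrite Ws => /(_ sh) st.
have s0 : (0 < s)%N by case: s hs {sh sV Ws st} => //; lia.
have h4s : (h <= 4 * s ^ 2)%N.
  apply: leq_trans (ltnW hs) _; rewrite -[4%N]/(2 ^ 2)%N -expnMn leq_exp2r //; lia.
have : (h * t ^ 6 <= 2 ^ 24 * h ^ 4)%N.
  apply: leq_trans (_ : 4 * s ^ 2 * t ^ 6 <= _)%N; first by rewrite leq_mul2r h4s orbT.
  have -> : (4 * s ^ 2 * t ^ 6 = 4 * (s * t ^ 3) ^ 2)%N by rewrite expnMn -expnM mulnA.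
  apply: leq_trans (_ : 4 * (2 ^ 11 * h ^ 2) ^ 2 <= _)%N; first by rewrite leq_mul2l leq_exp2r // st orbT.
  by rewrite (expnMn (2 ^ 11)) -!expnM mulnA -[4%N]/(2 ^ 2)%N -(expnD 2 2 (11 * 2)).
rewrite (expnS h 3) mulnCA leq_pmul2l // => le.
have : ((t ^ 2) ^ 3 <= (2 ^ 8 * h) ^ 3)%N by rewrite (expnMn (2 ^ 8)) -!expnM.
by rewrite leq_exp2r // leqNgt th.
Qed.

Lemma sum_diffs (F : finFieldType) (h : nat) : (0 < h)%N ->
  (\sum_(u : F) diffs h u <= h ^ 2)%N.
Proof.
move=> h0; pose H := [set x : F | x ^+ h == 1].
have -> : (\sum_(u : F) diffs h u = \sum_(x in H) \sum_(u : F | (x - u)%R ^+ h == 1%R) 1)%N.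
  rewrite (exchange_big_dep predT) //=; apply: eq_bigr => u _.
  rewrite /diffs -sum1_card; apply: eq_bigl => x; by rewrite !inE.
apply: leq_trans (_ : \sum_(x in H) h <= _)%N; last first.
  by rewrite sum_nat_const leq_mul2r card_unity_roots ?orbT.
apply: leq_sum => x _; rewrite sum1_card.
apply: leq_trans (card_unity_roots 1 h0).
have inj : injective (fun u => x - u) by move=> u v /addrI/oppr_inj.
rewrite -(card_imset _ inj); apply/subset_leq_card/fintype.subsetP.
by move=> _ /imsetP[u + ->]; rewrite !inE.
Qed.

(** Layer-cake formula for a square, with the layers below M treated
    trivially. *)
Lemma sqrn_le_sum_tail (M h j : nat) : (j <= h)%N ->
  (j ^ 2 <= M * j + \sum_(M <= t < h.+1 | t <= j) 2 * t)%N.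
Proof.
move=> jh; have [jM|Mj] := leqP j M.
  by rewrite (leq_trans _ (leq_addr _ _)) // leq_mul2r jM orbT.
have -> : (\sum_(M <= t < h.+1 | t <= j) 2 * t = \sum_(M <= t < j.+1) 2 * t)%N.
  rewrite (@big_cat_nat _ _ _ j.+1) //= ?leqW //; last exact: ltnW.
  rewrite [X in (_ + X)%N]big1_seq ?addn0; last first.
    by move=> t /andP[tj]; rewrite mem_index_iota leqNgt ltnS tj.
  rewrite big_seq_cond [RHS]big_seq_cond; apply: eq_bigl => t.
  by rewrite mem_index_iota ltnS; case: (t <= j)%N; rewrite ?andbF ?andbT.
have : (j ^ 2 <= M ^ 2 + \sum_(M <= t < j.+1) 2 * t)%N.
  have := ltnW Mj; elim: {jh Mj} j => [|j IH]; first by rewrite leqn0 => /eqP ->.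
  rewrite leq_eqVlt => /predU1P[->|]; first exact: leq_addr.
  rewrite ltnS => Mj; rewrite big_nat_recr /= ?leqW //.
  by have := IH Mj; nia.
by move/leq_trans; apply; rewrite leq_add2r leq_mul2l ltnW ?orbT.
Qed.

Lemma sum_inv_sqr_tail (R : realFieldType) (M n : nat) : (0 < M)%N ->
  \sum_(M <= t < n) (t%:R ^- 2 : R) <= 2 / M%:R.
Proof.
move=> M0; have [nM|Mn] := leqP n M.
  by rewrite big_geq // divr_ge0 ?ler0n.
suff : \sum_(M <= t < n) (t%:R ^- 2 : R) <= 2 / M%:R - 2 / n%:R.
  by move/le_trans; apply; rewrite gerDl oppr_le0 divr_ge0 ?ler0n.
have := ltnW Mn; elim: {Mn} n => [|n IH]; first by rewrite leqn0 => /eqP M00; rewrite M00 in M0.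
rewrite leq_eqVlt => /predU1P[<-|]; first by rewrite big_geq // subrr.
rewrite ltnS => Mn; rewrite big_nat_recr //=.
have n0 : 0 < n%:R :> R by rewrite ltr0n (leq_trans M0).
have n1 : 1 <= n%:R :> R by rewrite ler1n (leq_trans M0).
apply: le_trans (lerD (IH Mn) (lexx _)) _.
rewrite -addrA lerD2l -(natr1 n); move: (n%:R : R) n0 n1 => x x0 x1.
rewrite -subr_ge0.
have -> : - (2 / (x + 1)) - (- (2 / x) + x ^- 2) = (x - 1) / (x ^+ 2 * (x + 1)).
  by field; rewrite !gt_eqF //; lra.
by rewrite divr_ge0 ?mulr_ge0 ?sqr_ge0 //; lra.
Qed.

(** Split the layer-cake formula at M of size 16 sqrt h. The differences
    with at most M representations contribute at most M h^2, and the popular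
    ones contribute at most a multiple of the sum of t h^3 / t^3 over t >= M,
    which is of order h^3 / M. The energy is thus O(h^(5/2)); the constant is
    rounded up to a sixth power because a sixth root is taken later. *)
Lemma energy_bound (R : realFieldType) (F : finFieldType) (P h : nat)
    (charP : forall n, (0 < n < P)%N -> n%:R != 0 :> F) :
  (4 * h ^ 3 <= P ^ 2)%N -> (4 <= h)%N ->
  (\sum_(u : F) (diffs h u)%:R ^+ 2) ^+ 2 <= 11%:R ^+ 6 * h%:R ^+ 5 :> R.
Proof.
move=> hP h4; have h0 : (0 < h)%N by apply: leq_trans h4.
have [s /andP[sh hs]] := exists_sqrtn h.
have s0 : (0 < s)%N by case: s hs {sh} => //; lia.
have [M ME] : exists M, M = (16 * s.+1)%N by eexists.
have M2 : (256 * h < M ^ 2)%N by rewrite ME expnMn -[256%N]/(16 ^ 2)%N ltn_pmul2l.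
have Jh (u : F) : (diffs h u <= h)%N.
  apply: leq_trans (card_unity_roots (1 : F) h0); rewrite /diffs subset_leq_card //.
  by apply/fintype.subsetP => x; rewrite !inE => /andP[].
have E1 : (\sum_(u : F) diffs h u ^ 2 <= h ^ 2 + (M * h ^ 2 +
    \sum_(M <= t < h.+1) 2 * t * #|[set u : F | (u != 0%R) && (t <= diffs h u)]|))%N.
  rewrite (bigD1 0) //=; apply: leq_add; first by rewrite leq_exp2r.
  apply: leq_trans (_ : \sum_(u : F | u != 0%R) (M * diffs h u +
      \sum_(M <= t < h.+1 | t <= diffs h u) 2 * t) <= _)%N.
    by apply: leq_sum => u _; apply: sqrn_le_sum_tail.
  rewrite big_split /=; apply: leq_add.
    rewrite -big_distrr leq_mul2l; apply/orP; right.
    by apply: leq_trans (sum_diffs F h0); rewrite [leqRHS](bigD1 0) //= leq_addl.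
  rewrite (exchange_big_dep predT) //=; apply: leq_sum => t _.
  by rewrite sum_nat_const mulnC leq_eqVlt; apply/orP; left; apply/eqP; congr (_ * _)%N; apply: eq_card => u; rewrite !inE.
have hR : 0 < h%:R :> R by rewrite ltr0n.
have sR : 0 < s.+1%:R :> R by rewrite ltr0n.
have MR : 0 < M%:R :> R by rewrite ltr0n ME.
have E2 : (\sum_(u : F) (diffs h u)%:R ^+ 2 : R) <= 545%:R * s.+1%:R * h%:R ^+ 2.
  under eq_bigr do rewrite -natrX.
  rewrite -natr_sum; apply: (@le_trans _ _ (h%:R ^+ 2 + (M%:R * h%:R ^+ 2 + 2 ^+ 12 * h%:R ^+ 3 * (2 / M%:R)))).
    apply: (@le_trans _ _ (_%:R)); first by rewrite ler_nat; exact: E1.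
    rewrite !natrD natrX; apply: lerD => //; apply: lerD; first by rewrite natrM natrX.
    rewrite natr_sum.
    apply: le_trans (ler_wpM2l _ (sum_inv_sqr_tail R h.+1 _)); last first.
    - by rewrite ME muln_gt0.
    - by rewrite mulr_ge0 ?exprn_ge0 ?ler0n.
    rewrite mulr_sumr big_nat_cond [leRHS]big_nat_cond; apply: ler_sum => t /andP[/andP[Mt _] _].
    have t0 : 0 < t%:R :> R by rewrite ltr0n (leq_trans _ Mt) // ME.
    rewrite ler_pdivlMr ?exprn_gt0 // -!natrX -!natrM ler_nat.
    have := @card_popular_diffs F P h t charP hP h4; set U := #|_|.
    move=> /(_ (leq_trans M2 _)); rewrite leq_exp2r // => /(_ Mt) le.
    have -> : (2 * t * U * t ^ 2 = 2 * (U * t ^ 3))%N by ring.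
    by rewrite (expnS 2 11) -(mulnA 2 (2 ^ 11)%N) leq_mul2l le.
  have hs2 : h%:R <= s.+1%:R ^+ 2 :> R by rewrite -natrX ler_nat ltnW.
  have s1 : 1 <= s.+1%:R :> R by rewrite ler1n.
  rewrite ME natrM.
  move: (h%:R : R) (s.+1%:R : R) hR sR hs2 s1 => x y x0 y0 xy y1.
  have -> : 2 ^+ 12 * x ^+ 3 * (2 / (16%:R * y)) = 512%:R * x ^+ 2 * (x / y).
    by field; rewrite gt_eqF.
  have : x / y <= y by rewrite ler_pdivrMr.
  move: (x / y) => z zy; have x2 : 0 < x ^+ 2 by rewrite exprn_gt0.
  by move: (x ^+ 2) x2 => w w0; nra.
have s4 : s.+1%:R ^+ 2 <= 4%:R * h%:R :> R.
  rewrite -natrX -natrM ler_nat; apply: leq_trans (_ : 4 * s ^ 2 <= _)%N; last by rewrite leq_mul2l sh orbT.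
  by rewrite -[4%N]/(2 ^ 2)%N -expnMn leq_exp2r //; lia.
apply: le_trans (_ : (545%:R * s.+1%:R * h%:R ^+ 2) ^+ 2 <= _).
  by rewrite ler_sqr ?nnegrE //; apply: sumr_ge0 => u _; apply: sqr_ge0.
move: (h%:R : R) (s.+1%:R : R) hR sR s4 => x y x0 y0 xy.
have -> : (545%:R * y * x ^+ 2) ^+ 2 = 297025%:R * x ^+ 4 * y ^+ 2 by ring.
have x4 : 0 < x ^+ 4 by rewrite exprn_gt0.
rewrite (exprS x 4); move: (x ^+ 4) (y ^+ 2) x4 xy => w v w0 vx; nra.
Qed.

(** * Complex exponentials and the Cauchy-Schwarz inequality *)

Local Notation normc := ComplexField.Normc.normc.

Lemma sqr_normcE (R : realType) (z : R[i]) : ((normc z) ^+ 2)%:C = z * z^*%C.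
Proof. by rewrite rmorphXn /= -sqr_normc; case: z. Qed.

Lemma normc_ge0 (R : realType) (z : R[i]) : 0 <= normc z.
Proof. by case: z => a b; rewrite /= sqrtr_ge0. Qed.

Lemma normc_sum_le (R : realType) (I : Type) (r : seq I) (P : pred I) (F : I -> R[i]) :
  normc (\sum_(i <- r | P i) F i) <= \sum_(i <- r | P i) normc (F i).
Proof.
elim/big_rec2: _ => [|i y z _ le]; first by rewrite ComplexField.Normc.normc0.
by apply: le_trans (le_normcD _ _) _; rewrite lerD2l.
Qed.

Lemma normcJ_eq (R : realType) (z : R[i]) : normc z^*%C = normc z.
Proof. by case: z => a b; rewrite /= sqrrN. Qed.

(** Lagrange's identity. *)
Lemma cauchy_schwarz (R : realType) (I : finType) (P : pred I) (a b : I -> R) :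
  (\sum_(i | P i) a i * b i) ^+ 2 <=
  (\sum_(i | P i) a i ^+ 2) * (\sum_(i | P i) b i ^+ 2).
Proof.
have : 0 <= \sum_(i | P i) \sum_(j | P j) (a i * b j - a j * b i) ^+ 2.
  by apply: sumr_ge0 => i _; apply: sumr_ge0 => j _; apply: sqr_ge0.
set A := \sum_(i | _) a _ ^+ 2; set B := \sum_(i | _) b _ ^+ 2; set D := \sum_(i | _) _ * _.
have -> : \sum_(i | P i) \sum_(j | P j) (a i * b j - a j * b i) ^+ 2 = 2 * (A * B) - 2 * D ^+ 2.
  under eq_bigr => i _.
    under eq_bigr => j _.
      rewrite (_ : (a i * b j - a j * b i) ^+ 2 = a i ^+ 2 * b j ^+ 2 +
         b i ^+ 2 * a j ^+ 2 + (- 2 * (a i * b i)) * (a j * b j)); last by ring.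
    over.
    rewrite !big_split /= -!mulr_sumr -/A -/B -/D.
  over.
  rewrite !big_split /= -!mulr_suml -mulr_sumr -/A -/B -/D; ring.
by move=> le; lra.
Qed.

Lemma cauchy_schwarz_normc (R : realType) (I : finType) (P : pred I) (a b : I -> R[i]) :
  normc (\sum_(i | P i) a i * b i) ^+ 2 <=
  (\sum_(i | P i) normc (a i) ^+ 2) * (\sum_(i | P i) normc (b i) ^+ 2).
Proof.
apply: le_trans (cauchy_schwarz P (fun i => normc (a i)) (fun i => normc (b i))).
rewrite ler_sqr ?nnegrE ?normc_ge0 //; last by apply: sumr_ge0 => i _; rewrite mulr_ge0 ?normc_ge0.
apply: le_trans (normc_sum_le _ _ _) _; apply: ler_sum => i _.
by rewrite ComplexField.Normc.normcM.
Qed.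

Lemma e2pi0 (R : realType) : e2pi (0 : R) = 1.
Proof. by rewrite /e2pi mulr0 cos0 sin0. Qed.

Lemma e2piD (R : realType) (x y : R) : e2pi (x + y) = e2pi x * e2pi y.
Proof.
rewrite /e2pi mulrDr cosD sinD; apply/eqP; rewrite eq_complex /=.
by apply/andP; split; apply/eqP; ring.
Qed.

Lemma conj_e2pi (R : realType) (x : R) : (e2pi x)^*%C = e2pi (- x).
Proof. by rewrite /e2pi mulrN cosN sinN. Qed.

Lemma normc_e2pi (R : realType) (x : R) : normc (e2pi x) = 1.
Proof. by rewrite /= cos2Dsin2 sqrtr1. Qed.

Lemma e2pi_int (R : realType) (k : int) : e2pi (k%:~R : R) = 1.
Proof. by rewrite -[_%:~R]add0r e2piDz e2pi0. Qed.

Lemma e2pi_nat (R : realType) (n : nat) : e2pi (n%:R : R) = 1.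
Proof. by rewrite pmulrn e2pi_int. Qed.

Lemma e2piMn (R : realType) (x : R) (n : nat) : e2pi (x *+ n) = e2pi x ^+ n.
Proof. by elim: n => [|n IH]; rewrite ?mulr0n ?e2pi0 // mulrS exprS e2piD IH. Qed.

(** On [1/4, 1/2] the point e(x) lies in the left half-plane. Smaller x
    reduce to this range by doubling, since |e(2 x) - 1| <= 2 |e(x) - 1|. *)
Lemma normc_e2pi_sub1 (R : realType) (x : R) :
  0 <= x <= 1 / 2 -> 2 * x <= normc (e2pi x - 1).
Proof.
have base (y : R) : 1 / 4 <= y <= 1 / 2 -> 2 * y <= normc (e2pi y - 1).
  move=> /andP[y4 y2]; apply: (@le_trans _ _ 1); first by lra.
  have -> : normc (e2pi y - 1) = Num.sqrt (2 - 2 * cos (2 * pi * y)).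
    rewrite /= oppr0 addr0; congr Num.sqrt.
    by have := cos2Dsin2 (2 * pi * y); move: (cos _) (sin _) => c s cs; lra.
  rewrite -[X in X <= _]sqrtr1 ler_wsqrtr //.
  have -> : cos (2 * pi * y) = - cos (2 * pi * y - pi).
    by rewrite -cosDpi subrK.
  have p0 := @pi_gt0 R; have : 0 <= cos (2 * pi * y - pi).
    have h1 : 0 <= pi * (y - 1 / 4) by apply: mulr_ge0; lra.
    have h2 : 0 <= pi * (1 / 2 - y) by apply: mulr_ge0; lra.
    by apply: cos_ge0_pihalf; apply/andP; split; lra.
  by lra.
move=> /andP[]; rewrite le_eqVlt => /predU1P[<- _|x0 xh].
  by rewrite mulr0 normc_ge0.
have [k xk] : exists k : nat, 1 / (4 * 2 ^+ k) <= x.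
  have [k kx] : exists k : nat, x^-1 <= 2 ^+ k.
    exists (Num.truncn x^-1).+1; apply: ltW.
    apply: lt_le_trans (_ : (Num.truncn x^-1).+1%:R <= _); first exact: truncnS_gt.
    by rewrite -natrX ler_nat ltnW // ltn_expl.
  exists k; rewrite ler_pdivrMr ?mulr_gt0 ?exprn_gt0 //.
  rewrite -(ler_pM2l x0) divff ?gt_eqF // in kx.
  by move: (2 ^+ k : R) kx => t; lra.
elim: k x x0 xh xk => [|k IH] x x0 xh xk.
  by apply: base; rewrite expr0 mulr1 in xk; rewrite xk.
have [x4|x4] := leP (1 / 4) x; first by apply: base; rewrite x4.
have : 2 * (2 * x) <= normc (e2pi (2 * x) - 1).
  apply: IH; [by lra|by lra|].
  rewrite exprS in xk; have t0 : 0 < 2 ^+ k :> R by rewrite exprn_gt0.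
  rewrite ler_pdivrMr ?mulr_gt0 // in xk; rewrite ler_pdivrMr ?mulr_gt0 //.
  by move: (2 ^+ k : R) xk t0 => t; lra.
have -> : e2pi (2 * x) - 1 = (e2pi x - 1) * (e2pi x + 1).
  by rewrite mulr_natl e2piMn; ring.
rewrite ComplexField.Normc.normcM.
have : normc (e2pi x + 1) <= 2.
  apply: le_trans (le_normcD _ _) _.
  by rewrite normc_e2pi ComplexField.Normc.normc1.
have := normc_ge0 (e2pi x - 1).
move: (normc _) (normc _) => a b; nra.
Qed.

Lemma e2pi_eq1 (R : realType) (x : R) : 0 < x < 1 -> e2pi x != 1.
Proof.
move=> /andP[x0 x1]; apply/eqP => e.
have [xh|xh] := leP x (1 / 2).
  have := @normc_e2pi_sub1 R x; rewrite e subrr ComplexField.Normc.normc0.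
  by rewrite (ltW x0) xh => /(_ isT); lra.
have := @normc_e2pi_sub1 R (1 - x).
rewrite e2piD -conj_e2pi e conjc1 (e2pi_nat R 1) mulr1 subrr ComplexField.Normc.normc0.
by move=> h; have : 2 * (1 - x) <= 0; [apply: h; apply/andP; split; lra|lra].
Qed.

Lemma geometric_sum_eq0 (F : fieldType) (z : F) (n : nat) :
  z ^+ n = 1 -> z != 1 -> \sum_(i < n) z ^+ i = 0.
Proof.
move=> zn z1; have := subrX1 z n; rewrite zn subrr => /esym/eqP.
by rewrite mulf_eq0 subr_eq0 (negbTE z1) => /eqP.
Qed.

Lemma sum_e2pi_div (R : realType) (d : nat) (k : int) : (0 < d)%N ->
  \sum_(b < d) e2pi (b%:R * (k%:~R / d%:R) : R) = if (d %| k)%Z then d%:R else 0.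
Proof.
move=> d0; have dR : d%:R != 0 :> R by rewrite pnatr_eq0 -lt0n.
under eq_bigr => b _ do rewrite mulr_natl e2piMn.
set z := e2pi _.
have zE : z = e2pi ((k %% d)%Z%:~R / d%:R).
  rewrite -(e2piDz _ (k %/ d)%Z) /z {1}(divz_eq k d) intrD intrM; congr e2pi.
  by rewrite -pmulrn; field.
case: ifPn => [/dvdz_mod0P kd|kd].
  have -> : z = 1 by rewrite zE kd mul0r e2pi0.
  by under eq_bigr do rewrite expr1n; rewrite sumr_const card_ord.
apply: geometric_sum_eq0.
  by rewrite /z -e2piMn -[_ *+ _]mulr_natr divfK // e2pi_int.
rewrite zE; apply: e2pi_eq1; have dz : d%:Z != 0 by rewrite eqz_nat -lt0n.
have d0' : 0 < d%:R :> R by rewrite ltr0n.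
rewrite divr_gt0 ?ltr0z ?ltr_pdivrMr ?mul1r //=; last first.
  by rewrite lt_def modz_ge0 // andbT; apply: contra kd => /eqP/dvdz_mod0P.
by rewrite pmulrn ltr_int ltz_pmod.
Qed.

Lemma geometric_e2pi_bound (R : realType) (M : nat) (x : R) : 0 < x <= 1 / 2 ->
  normc (\sum_(i < M) e2pi (x *+ i)) <= x^-1.
Proof.
move=> /andP[x0 xh]; have := subrX1 (e2pi x) M.
under eq_bigr do rewrite -e2piMn; set S := \sum_(i < M) _ => e.
have := @normc_e2pi_sub1 R x; rewrite ltW //= => /(_ xh) le.
have : normc (e2pi x ^+ M - 1) <= 2.
  apply: le_trans (le_normcD _ _) _.
  by rewrite -e2piMn normc_e2pi normcN ComplexField.Normc.normc1.
rewrite e ComplexField.Normc.normcM => le2.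
rewrite -[leRHS]mul1r ler_pdivlMr // -(ler_pM2l (ltr0Sn R 1)) mulr1.
apply: le_trans le2; rewrite mulrCA mulrC; apply: ler_wpM2r le; exact: normc_ge0.
Qed.

(** * Exponential sums over multiplicative subgroups *)

Lemma real_complex_sum (R : realType) (I : Type) (r : seq I) (P : pred I) (F : I -> R) :
  (\sum_(i <- r | P i) F i)%:C = \sum_(i <- r | P i) (F i)%:C :> R[i].
Proof. exact: rmorph_sum. Qed.

Lemma conjc_sum (R : realType) (I : Type) (r : seq I) (P : pred I) (F : I -> R[i]) :
  (\sum_(i <- r | P i) F i)^*%C = \sum_(i <- r | P i) (F i)^*%C.
Proof. exact: rmorph_sum. Qed.

(** The functions chi b separate only the classes of kappa: this covers
    both additive characters of a prime field (kappa injective) and characters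
    modulo d restricted to an interval of integers (kappa the residue). *)
Lemma parseval (R : realType) (B X K : finType) (chi : B -> X -> R[i])
    (kappa : X -> K) (q : R) (v : X -> R[i]) :
  (forall x y, \sum_b chi b x * (chi b y)^*%C = if kappa x == kappa y then q%:C else 0) ->
  \sum_b normc (\sum_x v x * chi b x) ^+ 2 =
  q * \sum_k normc (\sum_(x | kappa x == k) v x) ^+ 2.
Proof.
move=> orth; apply: (@complexI R); rewrite rmorphM /= !real_complex_sum.
under eq_bigr do rewrite sqr_normcE conjc_sum mulr_suml.
under [in RHS]eq_bigr do rewrite sqr_normcE conjc_sum mulr_suml.
rewrite exchange_big /= mulr_sumr.
transitivity (\sum_x \sum_y v x * (v y)^*%C * (if kappa x == kappa y then q%:C else 0)).
  apply: eq_bigr => x _; under eq_bigr do rewrite mulr_sumr.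
  rewrite exchange_big; apply: eq_bigr => y _; rewrite -orth mulr_sumr.
  by apply: eq_bigr => b _; rewrite rmorphM /=; ring.
rewrite (partition_big kappa predT) //=; apply: eq_bigr => k _.
rewrite mulr_sumr; apply: eq_bigr => x /eqP xk; rewrite mulr_sumr mulr_sumr big_mkcond /=.
rewrite [RHS]big_mkcond; apply: eq_bigr => y _; rewrite xk eq_sym.
by case: ifP => _; rewrite ?mulr0 // mulrC.
Qed.

Definition addchar (R : realType) (p : nat) (x : 'F_p) : R[i] :=
  e2pi ((x : nat)%:R / p%:R).

Lemma addchar_nat (R : realType) (p m : nat) : prime p ->
  addchar R (m%:R : 'F_p) = e2pi (m%:R / p%:R).
Proof.
move=> pp; rewrite /addchar val_Fp_nat //.
have p0 : p%:R != 0 :> R by rewrite pnatr_eq0 -lt0n prime_gt0.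
rewrite -(e2piDz _ (m %/ p)%N) [in RHS](divn_eq m p) natrD natrM; congr e2pi.
by rewrite -pmulrn; field.
Qed.

Lemma Fp_natE (p : nat) (x : 'F_p) : x = (x : nat)%:R.
Proof. by rewrite natr_Zp. Qed.

Lemma addcharD (R : realType) (p : nat) (x y : 'F_p) : prime p ->
  addchar R (x + y) = addchar R x * addchar R y.
Proof.
move=> pp; rewrite (Fp_natE x) (Fp_natE y) -natrD !addchar_nat // -e2piD.
by congr e2pi; rewrite natrD mulrDl.
Qed.

Lemma addchar0 (R : realType) (p : nat) : addchar R (0 : 'F_p) = 1.
Proof. by rewrite /addchar mul0r e2pi0. Qed.

Lemma addcharN (R : realType) (p : nat) (x : 'F_p) : prime p ->
  addchar R (- x) = (addchar R x)^*%C.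
Proof.
move=> pp; have : addchar R (- x) * addchar R x = (addchar R x)^*%C * addchar R x.
  by rewrite -addcharD // addNr addchar0 conj_e2pi -e2piD addNr e2pi0.
apply: mulIf; apply/eqP => /(congr1 (@normc R)).
by rewrite normc_e2pi ComplexField.Normc.normc0 => /eqP; rewrite oner_eq0.
Qed.

Lemma normc_addchar (R : realType) (p : nat) (x : 'F_p) : normc (addchar R x) = 1.
Proof. exact: normc_e2pi. Qed.

Lemma sum_addchar (R : realType) (p : nat) (u : 'F_p) : prime p ->
  \sum_(c : 'F_p) addchar R (c * u) = if u == 0 then p%:R else 0.
Proof.
move=> pp; case: (eqVneq u 0) => [->|u0].
  under eq_bigr do rewrite mulr0 addchar0.
  by rewrite sumr_const card_Fp.
transitivity (\sum_(c < p) e2pi (c%:R * (1%:~R / p%:R) : R)).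
  rewrite (reindex_onto (fun c : 'F_p => c / u) (fun c => c * u)) /=; last first.
    by move=> c _; rewrite mulfK.
  under eq_bigl do rewrite divfK // eqxx.
  under eq_bigr do rewrite divfK //.
  transitivity (\sum_(0 <= c < (Zp_trunc (pdiv p)).+2) (e2pi (c%:R / p%:R) : R[i])).
    by rewrite big_mkord.
  by rewrite (Fp_cast pp) big_mkord; apply: eq_bigr => c _; rewrite mulrA mulr1.
rewrite sum_e2pi_div ?prime_gt0 // dvdz1 /=.
by rewrite gtn_eqF ?prime_gt1.
Qed.

Definition subgroup_sum (R : realType) (p h : nat) (c : 'F_p) : R[i] :=
  \sum_(x : 'F_p | x ^+ h == 1) addchar R (c * x).

(** The difference of two elements of the group is u with multiplicity
    diffs h u. *)
Lemma subgroup_sum_expand (R : realType) (p h : nat) (c : 'F_p) : prime p ->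
  (normc (subgroup_sum R h c) ^+ 2)%:C =
  \sum_(u : 'F_p) (diffs h u)%:R%:C * addchar R (c * u).
Proof.
move=> pp; rewrite sqr_normcE conjc_sum mulr_suml.
transitivity (\sum_(x : 'F_p | x ^+ h == 1) \sum_(u : 'F_p | (x - u) ^+ h == 1) addchar R (c * u)).
  apply: eq_bigr => x _.
  rewrite mulr_sumr (reindex_onto (fun u => x - u) (fun y => x - y)); last first.
    by move=> y _; rewrite subKr.
  rewrite [LHS](eq_bigl (fun u => (x - u) ^+ h == 1)) => [|u]; last by rewrite subKr eqxx andbT.
  apply: eq_bigr => u _; rewrite -addcharN // -addcharD //.
  by congr addchar; rewrite mulrBr opprB addrC subrK.
rewrite (exchange_big_dep predT) //=; apply: eq_bigr => u _.
rewrite sumr_const /diffs rmorph_nat mulr_natl; congr (_ *+ _).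
by apply: eq_card => x; rewrite !inE.
Qed.

Lemma subgroup_sum_mul (R : realType) (p h : nat) (c z : 'F_p) :
  z != 0 -> z ^+ h = 1 -> subgroup_sum R h (c * z) = subgroup_sum R h c.
Proof.
move=> z0 zh; rewrite /subgroup_sum [RHS](reindex_onto (fun x => z * x) (fun x => x / z)) /=.
  apply: eq_big => x; first by rewrite exprMn zh mul1r mulrAC divff // mul1r eqxx andbT.
  by rewrite mulrA.
by move=> x _; rewrite mulrC divfK.
Qed.

Lemma second_moment (R : realType) (p h : nat) : prime p ->
  \sum_(c : 'F_p) normc (subgroup_sum R h c) ^+ 2 =
  p%:R * #|[set x : 'F_p | x ^+ h == 1]|%:R.
Proof.
move=> pp; transitivity (\sum_(c : 'F_p) normc (\sum_(x : 'F_p)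
    ((x ^+ h == 1)%:R : R[i]) * addchar R (c * x)) ^+ 2).
  apply: eq_bigr => c _; congr (normc _ ^+ 2).
  rewrite /subgroup_sum big_mkcond; apply: eq_bigr => x _.
  by case: ifP; rewrite ?mul1r ?mul0r.
rewrite (@parseval R _ _ _ (fun c x => addchar R (c * x)) id p%:R).
  congr (_ * _); rewrite -sum1_card natr_sum big_mkcond /=.
  rewrite [RHS]big_mkcond; apply: eq_bigr => x _; rewrite big_pred1_eq inE.
  by case: ifP => _; rewrite ?ComplexField.Normc.normc1 ?ComplexField.Normc.normc0 ?expr1n ?expr0n.
move=> x y; under eq_bigr do rewrite -addcharN // -addcharD // -mulrBr.
by rewrite sum_addchar // subr_eq0 rmorph_nat.
Qed.

Lemma fourth_moment (R : realType) (p h : nat) : prime p ->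
  \sum_(c : 'F_p) normc (subgroup_sum R h c) ^+ 4 =
  p%:R * \sum_(u : 'F_p) (diffs h u)%:R ^+ 2.
Proof.
move=> pp; transitivity (\sum_(c : 'F_p) normc (\sum_(u : 'F_p)
    ((diffs h u)%:R%:C : R[i]) * addchar R (c * u)) ^+ 2).
  apply: eq_bigr => c _; rewrite -subgroup_sum_expand //.
  by rewrite /= expr0n addr0 sqrtr_sqr ger0_norm ?sqr_ge0 // -exprM.
rewrite (@parseval R _ _ _ (fun c x => addchar R (c * x)) id p%:R).
  congr (_ * _); apply: eq_bigr => x _; rewrite big_pred1_eq.
  by rewrite /= expr0n addr0 sqrtr_sqr ger0_norm ?ler0n.
move=> x y; under eq_bigr do rewrite -addcharN // -addcharD // -mulrBr.
by rewrite sum_addchar // subr_eq0 rmorph_nat.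
Qed.

Lemma unity_root_neq0 (F : fieldType) (h : nat) (x : F) : (0 < h)%N -> x ^+ h = 1 -> x != 0.
Proof. by move=> h0 xh; apply/eqP => x0; move: xh; rewrite x0 expr0n gtn_eqF // => /eqP; rewrite eq_sym oner_eq0. Qed.

(** The h equal values |S(a z)|, z in the group, are part of a sum of
    squares whose total is p h. *)
Lemma subgroup_sum_gauss (R : realType) (p h : nat) (a : 'F_p) : prime p -> (0 < h)%N -> a != 0 ->
  #|[set x : 'F_p | x ^+ h == 1]| = h ->
  normc (subgroup_sum R h a) ^+ 2 <= p%:R.
Proof.
move=> pp h0 a0 Hh; have hR : 0 < h%:R :> R by rewrite ltr0n.
rewrite -(ler_pM2l hR) [leRHS]mulrC; have := second_moment R h pp; rewrite Hh => <-.
rewrite -{1}Hh -sum1_card natr_sum mulr_suml.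
rewrite (eq_bigr (fun z => normc (subgroup_sum R h (a * z)) ^+ 2)); last first.
  by move=> z /[!inE] /eqP zh; rewrite mul1r subgroup_sum_mul // (unity_root_neq0 h0 zh).
rewrite [leRHS](reindex_onto (fun z => a * z) (fun z => z / a)) /=; last first.
  by move=> z _; rewrite mulrC divfK.
rewrite [leRHS](eq_bigl predT) => [|z]; last by rewrite mulrAC divff // mul1r eqxx.
rewrite [leRHS](bigID (fun z => z \in [set x : 'F_p | x ^+ h == 1])) /=.
by rewrite lerDl sumr_ge0 // => z _; rewrite sqr_ge0.
Qed.

(** Averaging |S(a z)|^2 over z in the group expresses h |S(a)|^2 as the sum of
    J(u) S(a u), with J(u) the number of representations of u as a difference.
    Two applications of Cauchy-Schwarz separate the sum of J, equal to
    h^2, the sum of J^2, which is the energy, and the fourth moment of S, which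
    is p times the energy. *)
Lemma subgroup_sum_energy (R : realType) (p h : nat) (a : 'F_p) : prime p -> (0 < h)%N -> a != 0 ->
  #|[set x : 'F_p | x ^+ h == 1]| = h ->
  normc (subgroup_sum R h a) ^+ 8 <= p%:R * (\sum_(u : 'F_p) (diffs h u)%:R ^+ 2) ^+ 2.
Proof.
move=> pp h0 a0 Hh; have hR : 0 < h%:R :> R by rewrite ltr0n.
set s := normc _; set E := \sum_(u : 'F_p) _.
pose t (u : 'F_p) := normc (subgroup_sum R h (a * u)).
pose J (u : 'F_p) : R := (diffs h u)%:R.
have t0 u : 0 <= t u by apply: normc_ge0.
have J0 u : 0 <= J u by apply: ler0n.
have s0 : 0 <= s by apply: normc_ge0.
have e1 : h%:R * s ^+ 2 <= \sum_u J u * t u.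
  have -> : h%:R * s ^+ 2 = normc (\sum_u (J u)%:C * subgroup_sum R h (a * u)).
    have -> : \sum_u (J u)%:C * subgroup_sum R h (a * u) = (h%:R * s ^+ 2)%:C.
      rewrite rmorphM /= rmorph_nat -{2}Hh -sum1_card natr_sum mulr_suml.
      rewrite [RHS](eq_bigr (fun z => \sum_(u : 'F_p) (J u)%:C * addchar R (a * z * u))); last first.
        move=> z /[!inE] /eqP zh.
        by rewrite mul1r -subgroup_sum_expand // subgroup_sum_mul // (unity_root_neq0 h0 zh).
      rewrite exchange_big; apply: eq_bigr => u _; rewrite -mulr_sumr /subgroup_sum; congr (_ * _).
      by apply: eq_big => z; rewrite ?inE // mulrAC.
    by rewrite /= expr0n addr0 sqrtr_sqr ger0_norm // mulr_ge0 ?sqr_ge0 ?ltW.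
  apply: le_trans (normc_sum_le _ _ _) _; apply: ler_sum => u _.
  by rewrite ComplexField.Normc.normcM /= expr0n addr0 sqrtr_sqr ger0_norm.
have e2 : (\sum_u J u * t u) ^+ 2 <= h%:R ^+ 2 * \sum_u J u * t u ^+ 2.
  have := cauchy_schwarz predT (fun u => Num.sqrt (J u)) (fun u => Num.sqrt (J u) * t u).
  under eq_bigr do rewrite mulrA -expr2 sqr_sqrtr //.
  under [X in _ <= X * _]eq_bigr do rewrite sqr_sqrtr //.
  under [X in _ <= _ * X]eq_bigr do rewrite exprMn sqr_sqrtr //.
  move/le_trans; apply; apply: ler_wpM2r.
    by apply: sumr_ge0 => u _; rewrite mulr_ge0 ?sqr_ge0.
  by rewrite /J -natr_sum -natrX ler_nat sum_diffs.
have e3 : (\sum_u J u * t u ^+ 2) ^+ 2 <= E * (p%:R * E).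
  apply: le_trans (cauchy_schwarz _ _ _) _; rewrite /E -fourth_moment //.
  rewrite [X in _ <= _ * X](reindex_onto (fun z => a * z) (fun z => z / a)) /=; last first.
    by move=> z _; rewrite mulrC divfK.
  rewrite [X in _ <= _ * X](eq_bigl predT) => [|z]; last by rewrite mulrAC divff // mul1r eqxx.
  apply: ler_wpM2l; first by apply: sumr_ge0 => u _; rewrite sqr_ge0.
  by apply: ler_sum => u _; rewrite -exprM.
set U := \sum_u J u * t u ^+ 2 in e2 e3.
have U0 : 0 <= U by apply: sumr_ge0 => u _; rewrite mulr_ge0 ?sqr_ge0.
have h1 : 0 <= h%:R * s ^+ 2 by rewrite mulr_ge0 ?sqr_ge0 ?ltW.
have e4 : (h%:R * s ^+ 2) ^+ 2 <= h%:R ^+ 2 * U.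
  by apply: le_trans e2; rewrite ler_sqr ?nnegrE // (le_trans h1).
have e5 : s ^+ 4 <= U.
  rewrite exprMn ler_pM2l ?exprn_gt0 // in e4.
  by rewrite -exprM in e4.
have -> : s ^+ 8 = (s ^+ 4) ^+ 2 by rewrite -exprM.
have -> : p%:R * E ^+ 2 = E * (p%:R * E) by ring.
by apply: le_trans e3; rewrite ler_sqr ?nnegrE ?exprn_ge0.
Qed.

(** The energy bound covers 4 <= h << p^(2/3). For larger h the bound
    |S|^2 <= p is stronger than the claim, and for h < 4 so is |S| <= h. *)
Lemma subgroup_sum_bound (R : realType) (p h : nat) (a : 'F_p) : prime p -> (0 < h)%N -> a != 0 ->
  #|[set x : 'F_p | x ^+ h == 1]| = h ->
  normc (subgroup_sum R h a) ^+ 8 <= 11%:R ^+ 6 * p%:R * h%:R ^+ 5.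
Proof.
move=> pp h0 a0 Hh; have hR : 1 <= h%:R :> R by rewrite ler1n.
have pR : 1 <= p%:R :> R by rewrite ler1n prime_gt0.
have s0 := normc_ge0 (subgroup_sum R h a).
(* 64 is the constant needed when h is below 4 or at least of order p^(2/3). *)
have c1 : 64%:R <= 11%:R ^+ 6 :> R.
  by apply: (@le_trans _ _ (11%:R ^+ 2)); [rewrite -natrX ler_nat|rewrite ler_eXn2l // ltr1n].
have [h4|h4] := ltnP h 4.
  have : normc (subgroup_sum R h a) <= h%:R.
    apply: le_trans (normc_sum_le _ _ _) _.
    under eq_bigr do rewrite normc_addchar.
    rewrite sumr_const ler_nat -{2}Hh leq_eqVlt; apply/orP; left; apply/eqP.
    by apply: eq_card => x; rewrite inE.
  move=> le; apply: le_trans (_ : h%:R ^+ 8 <= _); first by rewrite lerXn2r ?nnegrE // (le_trans s0).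
  rewrite (exprD _ 3 5) ler_pM2r ?exprn_gt0 ?(lt_le_trans ltr01) //.
  apply: le_trans (_ : 64%:R <= _).
    by rewrite -natrX ler_nat -[64%N]/(4 ^ 3)%N leq_exp2r // ltnW.
  apply: le_trans c1 _; rewrite ler_peMr // exprn_ge0 ?ler0n //.
have [hp|hp] := leqP (4 * h ^ 3) (p ^ 2).
  apply: le_trans (subgroup_sum_energy R pp h0 a0 Hh) _.
  rewrite mulrAC [leRHS]mulrC; apply: ler_wpM2l; first by rewrite ler0n.
  apply: energy_bound hp h4 => n /andP[n0 np].
  by rewrite -(dvdn_pcharf (pchar_Fp pp)) gtnNdvd.
have -> : normc (subgroup_sum R h a) ^+ 8 = (normc (subgroup_sum R h a) ^+ 2) ^+ 4 by rewrite -exprM.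
apply: le_trans (_ : p%:R ^+ 4 <= _).
  by rewrite lerXn2r ?nnegrE ?sqr_ge0 ?ler0n // subgroup_sum_gauss.
rewrite exprS mulrAC [leRHS]mulrC; apply: ler_wpM2l; first by rewrite ler0n.
apply: le_trans (_ : 64%:R * h%:R ^+ 5 <= _); last by rewrite ler_wpM2r // exprn_ge0 // ler0n.
rewrite -!natrX -natrM ler_nat -(leq_exp2r _ _ (e := 2)) //.
apply: leq_trans (_ : (4 * h ^ 3) ^ 3 <= _)%N.
  by rewrite -expnM (expnM p 2 3) leq_exp2r // ltnW.
rewrite (expnMn 4) (expnMn 64) -!expnM.
apply: leq_trans (_ : 64 ^ 2 * h ^ 9 <= _)%N; first by rewrite leq_mul2r orbC; apply/orP; left.
by rewrite leq_mul2l leq_pexp2l // orbT.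
Qed.

Lemma unity_roots_primitive (F : finFieldType) (h : nat) (g : F) : h.-primitive_root g ->
  [set x : F | x ^+ h == 1] = [set g ^+ (i : nat) | i : 'I_h].
Proof.
move=> gh; apply/setP => x; rewrite inE; apply/eqP/imsetP => [/(prim_rootP gh)[i ->]|[i _ ->]].
  by exists i.
by rewrite exprAC (prim_expr_order gh) expr1n.
Qed.

Lemma primitive_sum_bound (R : realType) (p h : nat) (a g : 'F_p) : prime p ->
  h.-primitive_root g -> a != 0 ->
  normc (\sum_(i < h) addchar R (a * g ^+ i)) ^+ 8 <= 11%:R ^+ 6 * p%:R * h%:R ^+ 5.
Proof.
move=> pp gh a0; have h0 := prim_order_gt0 gh.
have inj : injective (fun i : 'I_h => g ^+ i).
  move=> i j /eqP; rewrite (eq_prim_root_expr gh) !modn_small // => /eqP.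
  exact: val_inj.
have HE := unity_roots_primitive gh.
have := @subgroup_sum_bound R p h a pp h0 a0.
rewrite /subgroup_sum HE card_imset // card_ord => /(_ erefl).
rewrite [X in normc X ^+ 8 <= _](eq_bigl (mem [set g ^+ (i : nat) | i : 'I_h])).
  by rewrite big_imset //=; move=> i j _ _; apply: inj.
by move=> x; rewrite /= -HE inE.
Qed.

(** * The large sieve inequality *)

Lemma conjcM (R : realType) (x y : R[i]) : (x * y)^*%C = x^*%C * y^*%C.
Proof. exact: rmorphM. Qed.

Definition dirichlet (R : realType) (M : nat) (x : R) : R[i] := \sum_(i < M) e2pi (x *+ i).

Lemma normc_dirichletN (R : realType) (M : nat) (x : R) :
  normc (dirichlet M (- x)) = normc (dirichlet M x).
Proof.
rewrite -[RHS]normcJ_eq; congr normc; rewrite /dirichlet conjc_sum.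
by apply: eq_bigr => i _; rewrite conj_e2pi mulNrn.
Qed.

Lemma dirichletD1 (R : realType) (M : nat) (x : R) :
  dirichlet M (x + 1) = dirichlet M x.
Proof.
by apply: eq_bigr => i _; rewrite mulrnDl e2piD e2pi_nat mulr1.
Qed.

Lemma normc_dirichlet_le (R : realType) (M : nat) (x : R) :
  normc (dirichlet M x) <= M%:R.
Proof.
apply: le_trans (normc_sum_le _ _ _) _.
under eq_bigr do rewrite normc_e2pi.
by rewrite sumr_const card_ord.
Qed.

(** Bounds the square of the Dirichlet kernel at points at distance at least
    j / q from the integers. *)
Definition dirichlet_majorant (R : realType) (M q j : nat) : R :=
  if j == 0%N then M%:R ^+ 2 else q%:R ^+ 2 * j%:R ^- 2.

Lemma dirichlet_majorant_ge0 (R : realType) (M q j : nat) :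
  0 <= dirichlet_majorant R M q j.
Proof. by rewrite /dirichlet_majorant; case: ifP => _; rewrite ?mulr_ge0 ?invr_ge0 ?exprn_ge0 ?ler0n. Qed.

Lemma dirichlet_le_majorant (R : realType) (M q j : nat) (x : R) : (0 < q)%N ->
  0 <= x <= 1 / 2 -> j%:R <= x * q%:R ->
  normc (dirichlet M x) ^+ 2 <= dirichlet_majorant R M q j.
Proof.
move=> q0 /andP[x0 xh] jx; rewrite /dirichlet_majorant; case: (posnP j) => [_|j0].
  by rewrite lerXn2r ?nnegrE ?normc_ge0 ?ler0n // normc_dirichlet_le.
have qR : 0 < q%:R :> R by rewrite ltr0n.
have jR : 0 < j%:R :> R by rewrite ltr0n.
have x1 : 0 < x by rewrite -(pmulr_lgt0 _ qR) (lt_le_trans jR).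
rewrite -exprVn -exprMn lerXn2r ?nnegrE ?normc_ge0 ?divr_ge0 ?ler0n //.
apply: le_trans (geometric_e2pi_bound M _) _; first by rewrite x1.
by rewrite ler_pdivlMr // mulrC ler_pdivrMr // mulrC.
Qed.

Lemma sum_dirichlet_majorant (R : realType) (M q : nat) :
  \sum_(j < q) dirichlet_majorant R M q j <= M%:R ^+ 2 + 2 * q%:R ^+ 2.
Proof.
case: q => [|q]; first by rewrite big_ord0 addr_ge0 ?mulr_ge0 ?sqr_ge0.
rewrite big_ord_recl /= {1}/dirichlet_majorant /= lerD2l.
have := @sum_inv_sqr_tail R 1 q.+1 isT; rewrite divr1 => le.
rewrite mulrC; apply: le_trans (ler_wpM2l (sqr_ge0 _) le); rewrite mulr_sumr.
by rewrite big_add1 /= big_mkord.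
Qed.

(** Weigh c i c j by the mean of the two squares. *)
Lemma schur_test (R : realType) (I : finType) (P : pred I) (K : I -> I -> R) (B : R) (c : I -> R) :
  (forall i j, 0 <= K i j) -> (forall i j, K i j = K j i) ->
  (forall i, P i -> \sum_(j | P j) K i j <= B) ->
  \sum_(i | P i) \sum_(j | P j) c i * c j * K i j <= B * \sum_(i | P i) c i ^+ 2.
Proof.
move=> K0 Ks KB.
apply: (@le_trans _ _ (\sum_(i | P i) \sum_(j | P j) (c i ^+ 2 / 2 * K i j + c j ^+ 2 / 2 * K i j))).
  apply: ler_sum => i _; apply: ler_sum => j _; rewrite -mulrDl; apply: ler_wpM2r => //.
  by have := sqr_ge0 (c i - c j); lra.
under eq_bigr do rewrite big_split.
rewrite big_split /= [X in _ + X]exchange_big /=.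
rewrite [X in _ + X](eq_bigr (fun i => \sum_(j | P j) c i ^+ 2 / 2 * K i j)); last first.
  by move=> i _; apply: eq_bigr => j _; rewrite Ks.
rewrite -big_split /= mulr_sumr; apply: ler_sum => i Pi; rewrite -!mulr_sumr -mulrDl -splitr mulrC.
by apply: ler_wpM2r (KB i Pi); apply: sqr_ge0.
Qed.

Lemma sum_injective_le (R : realType) (I : finType) (P : pred I) (q : nat)
    (f : I -> 'I_q) (g : nat -> R) :
  (forall j, 0 <= g j) -> {in P &, injective f} ->
  \sum_(i | P i) g (f i) <= \sum_(j < q) g j.
Proof.
move=> g0 inj; rewrite -(big_imset (fun j : 'I_q => g j) inj) /= big_mkcond.
by apply: ler_sum => j _; case: ifP.
Qed.

(** Translate by the r-th point. The bucket of a point s is the integer part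
    of q times the fractional part of alpha s - alpha r; the spacing allows at
    most one point per bucket, and the j-th bucket is at distance at
    least j / q or (q - 1 - j) / q from the integers. The majorants then sum to
    a convergent series. *)
Lemma dirichlet_row_sum (R : realType) (I : finType) (P : pred I) (alpha : I -> R)
    (M q : nat) :
  (0 < q)%N -> (forall i, P i -> 0 <= alpha i < 1) ->
  (forall i j, P i -> P j -> i != j ->
     1 / q%:R <= `|alpha i - alpha j| <= 1 - 1 / q%:R) ->
  forall r, P r -> \sum_(s | P s) normc (dirichlet M (alpha r - alpha s)) ^+ 2
    <= 2 * (M%:R ^+ 2 + 2 * q%:R ^+ 2).
Proof.
move=> q0 a01 sp r Pr; have qR : 0 < q%:R :> R by rewrite ltr0n.
pose beta s := if alpha r <= alpha s then alpha s - alpha r else alpha s - alpha r + 1.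
have b01 s : P s -> 0 <= beta s < 1.
  move=> Ps; have := a01 _ Ps; have := a01 _ Pr => /andP[? ?] /andP[? ?].
  by rewrite /beta; case: (leP (alpha r) (alpha s)) => ?; apply/andP; split; lra.
pose tr s := Num.truncn (beta s * q%:R).
have trP s : P s -> (tr s)%:R <= beta s * q%:R < (tr s).+1%:R.
  by move=> Ps; apply: truncn_itv; have /andP[? ?] := b01 _ Ps; rewrite mulr_ge0 // ltW.
have trq s : P s -> (tr s < q)%N.
  move=> Ps; have /andP[le _] := trP _ Ps; have /andP[_ lt] := b01 _ Ps.
  by rewrite -(ltr_nat R) (le_lt_trans le) // -[ltRHS]mul1r ltr_pM2r.
case: q q0 qR sp @tr trP trq => // q _ qR sp tr trP trq.
pose f s : 'I_q.+1 := inord (tr s).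
have fE s : P s -> f s = tr s :> nat by move=> Ps; rewrite /f inordK // trq.
(* Two points in one bucket would be less than 1 / q apart modulo 1. *)
have inj : {in P &, injective f}.
  move=> s s' Ps Ps' /(congr1 val) /=; rewrite !fE // => e.
  apply/eqP; apply: contraT => ss'; have := sp _ _ Ps Ps' ss'.
  have := trP _ Ps; have := trP _ Ps'; rewrite e -(natr1 (tr s')) => /andP[b1 b2] /andP[b3 b4].
  have : `|beta s - beta s'| < 1 / q.+1%:R.
    by rewrite ltr_pdivlMr // -[q.+1%:R in X in X < _]gtr0_norm // -normrM ltr_norml; apply/andP; split; lra.
  move: (1 / q.+1%:R : R) => e1; have := a01 _ Ps; have := a01 _ Ps'; have := a01 _ Pr.
  rewrite /beta => /andP[? ?] /andP[? ?] /andP[? ?]; rewrite ltr_norml => /andP[+ +] /andP[n1 n2].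
  have : (e1 <= alpha s - alpha s' <= 1 - e1) || (e1 <= alpha s' - alpha s <= 1 - e1).
    move: n1 n2; case: (ger0P (alpha s - alpha s')) => _ n1 n2; first by rewrite n1 n2.
    by rewrite opprB in n1 n2; rewrite n1 n2 orbT.
  by move=> /orP[] /andP[? ?]; case: (leP (alpha r) (alpha s)) => ?; case: (leP (alpha r) (alpha s')) => ? ? ?; lra.
pose G := dirichlet_majorant R M q.+1.
have G0 j : 0 <= G j by apply: dirichlet_majorant_ge0.
apply: (@le_trans _ _ (\sum_(s | P s) (G (f s) + G (q - f s)%N))).
  apply: ler_sum => s Ps; have /andP[bs0 bs1] := b01 _ Ps; have /andP[t1 t2] := trP _ Ps.
  have -> : normc (dirichlet M (alpha r - alpha s)) = normc (dirichlet M (beta s)).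
    rewrite -normc_dirichletN opprB /beta; case: ifP => // _; by rewrite dirichletD1.
  have [bh|bh] := leP (beta s) (1 / 2).
    apply: (@le_trans _ _ (G (f s))); last by rewrite lerDl.
    by apply: dirichlet_le_majorant => //; rewrite ?bs0 // fE.
  apply: (@le_trans _ _ (G (q - f s)%N)); last by rewrite lerDr.
  rewrite -normc_dirichletN -dirichletD1 addrC; apply: dirichlet_le_majorant => //.
    by apply/andP; split; lra.
  rewrite fE // natrB -1?ltnS ?trq // mulrBl mul1r.
  by rewrite -!natr1 in t2 *; lra.
rewrite big_split mulr_natl mulr2n; apply: lerD.
  by apply: le_trans (sum_injective_le G0 inj) (sum_dirichlet_majorant _ _ _).
apply: le_trans (sum_dirichlet_majorant R M q.+1).
rewrite [leRHS](reindex_inj rev_ord_inj) /=.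
rewrite [leRHS](eq_bigr (fun j : 'I_q.+1 => G (q - j)%N)) => [|j _]; last by rewrite subSS.
exact: (@sum_injective_le _ _ _ _ f (fun j => G (q - j)%N)).
Qed.

Definition trig_sum (R : realType) (I : finType) (P : pred I) (alpha : I -> R)
  (c : I -> R[i]) (x : R) : R[i] := \sum_(r | P r) c r * e2pi (alpha r * x).

Lemma sum_trig_sum_diff (R : realType) (I : finType) (P : pred I) (alpha : I -> R)
    (c : I -> R[i]) (M : nat) :
  (\sum_(j < M) \sum_(i < M) normc (trig_sum P alpha c (i%:R - j%:R)) ^+ 2)%:C =
  \sum_(r | P r) \sum_(s | P s) c r * (c s)^*%C * (normc (dirichlet M (alpha r - alpha s)) ^+ 2)%:C.
Proof.
rewrite real_complex_sum; under eq_bigr do rewrite real_complex_sum.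
under eq_bigr => j _.
  under eq_bigr => i _.
    rewrite sqr_normcE {2}/trig_sum conjc_sum mulr_suml.
    under eq_bigr do rewrite mulr_sumr.
    over.
  rewrite exchange_big /=.
  under eq_bigr do rewrite exchange_big /=.
  over.
rewrite exchange_big; apply: eq_bigr => r _; rewrite exchange_big; apply: eq_bigr => s _.
rewrite sqr_normcE /dirichlet conjc_sum mulr_sumr mulr_sumr; apply: eq_bigr => j _.
rewrite mulr_suml mulr_sumr; apply: eq_bigr => i _.
rewrite conjcM !conj_e2pi mulrACA -!e2piD; congr (_ * e2pi _).
by rewrite -[_ *+ i]mulr_natr -[_ *+ j]mulr_natr; ring.
Qed.

(** The Fejer weight: each m <= N is a difference i - j of numbers below
    M = 2 (N + q) in at least M / 2 ways, and summation over all such pairs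
    produces the positive kernel |D_M|^2, to which Schur's test applies. *)
Lemma large_sieve_dual (R : realType) (I : finType) (P : pred I) (alpha : I -> R)
    (c : I -> R[i]) (N q : nat) :
  (0 < q)%N -> (forall i, P i -> 0 <= alpha i < 1) ->
  (forall i j, P i -> P j -> i != j ->
     1 / q%:R <= `|alpha i - alpha j| <= 1 - 1 / q%:R) ->
  \sum_(m < N.+1) normc (trig_sum P alpha c m%:R) ^+ 2
    <= 12%:R * (N + q)%:R * \sum_(r | P r) normc (c r) ^+ 2.
Proof.
move=> q0 a01 sp; pose Q := (N + q)%N; pose M := (Q + Q)%N.
have QR : 0 < Q%:R :> R by rewrite ltr0n addn_gt0 q0 orbT.
pose K r s := normc (dirichlet M (alpha r - alpha s)) ^+ 2.
set S := \sum_(r | P r) normc (c r) ^+ 2.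
have S0 : 0 <= S by apply: sumr_ge0 => r _; apply: sqr_ge0.
have up : \sum_(j < M) \sum_(i < M) normc (trig_sum P alpha c (i%:R - j%:R)) ^+ 2 <=
    2 * (M%:R ^+ 2 + 2 * q%:R ^+ 2) * S.
  apply: le_trans (@schur_test R I P K _ (fun r => normc (c r)) _ _ (dirichlet_row_sum M q0 a01 sp)).
  - have := sum_trig_sum_diff P alpha c M; set W := \sum_(j < M) _ => WE.
    have -> : W = normc (\sum_(r | P r) \sum_(s | P s) c r * (c s)^*%C * (K r s)%:C).
      rewrite -WE /= expr0n addr0 sqrtr_sqr ger0_norm //.
      by do 2! (apply: sumr_ge0 => ? _); apply: sqr_ge0.
    apply: le_trans (normc_sum_le _ _ _) _; apply: ler_sum => r _.
    apply: le_trans (normc_sum_le _ _ _) _; apply: ler_sum => s _.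
    rewrite !ComplexField.Normc.normcM normcJ_eq /= expr0n addr0 sqrtr_sqr ger0_norm //.
    exact: sqr_ge0.
  - by move=> r s; apply: sqr_ge0.
  - by move=> r s; rewrite /K -normc_dirichletN opprB.
have low : Q%:R * \sum_(m < N.+1) normc (trig_sum P alpha c m%:R) ^+ 2 <=
    \sum_(j < M) \sum_(i < M) normc (trig_sum P alpha c (i%:R - j%:R)) ^+ 2.
  rewrite [leRHS](@big_split_ord _ _ _ Q Q) /= mulr_natl -[Q in _ *+ Q]card_ord -sumr_const.
  rewrite -[leLHS]addr0; apply: lerD; last first.
    by do 2! (apply: sumr_ge0 => ? _); apply: sqr_ge0.
  apply: ler_sum => j _.
  (* For each of the Q values j < M / 2 the shifts m + j are admissible i. *)
  have jM (m : 'I_N.+1) : (m + j < M)%N.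
    by have := ltn_ord m; have := ltn_ord j; rewrite /M /Q; lia.
  have inj : {in predT &, injective (fun m : 'I_N.+1 => Ordinal (jM m))}.
    by move=> m m' _ _ /(congr1 val) /= /addIn; apply: val_inj.
  rewrite (eq_bigr (fun m : 'I_N.+1 => normc (trig_sum P alpha c ((Ordinal (jM m) : nat)%:R - j%:R)) ^+ 2)).
    by apply: (@sum_injective_le R _ predT M _ (fun i => normc (trig_sum P alpha c (i%:R - j%:R)) ^+ 2) _ inj) => i; apply: sqr_ge0.
  by move=> m _; rewrite /= natrD addrK.
rewrite -(ler_pM2l QR); apply: le_trans low (le_trans up _).
have -> : M%:R = 2 * Q%:R :> R by rewrite /M natrD; ring.
have qQ : q%:R <= Q%:R :> R by rewrite ler_nat leq_addl.
rewrite !mulrA; apply: ler_wpM2r => //.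
have q00 : 0 <= q%:R :> R by rewrite ler0n.
rewrite -/Q; nra.
Qed.

(** Duality. Pairing the sums with their own conjugates and exchanging the
    order of summation bounds the square of the left-hand side by T times an
    instance of the dual inequality. *)
Lemma large_sieve (R : realType) (I : finType) (P : pred I) (alpha : I -> R)
    (N q T : nat) (s : nat -> nat) (gamma : nat -> R[i]) :
  (0 < q)%N -> (forall i, P i -> 0 <= alpha i < 1) ->
  (forall i j, P i -> P j -> i != j ->
     1 / q%:R <= `|alpha i - alpha j| <= 1 - 1 / q%:R) ->
  (forall n, n < T -> s n <= N)%N -> {in [pred n | (n < T)%N] &, injective s} ->
  (forall n, (n < T)%N -> normc (gamma n) <= 1) ->
  \sum_(r | P r) normc (\sum_(n < T) gamma n * e2pi (alpha r * (s n)%:R)) ^+ 2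
    <= 12%:R * (N + q)%:R * T%:R.
Proof.
move=> q0 a01 sp sN sinj g1; set Q := \sum_(r | P r) _.
pose z r := \sum_(n < T) gamma n * e2pi (alpha r * (s n)%:R).
have Q0 : 0 <= Q by apply: sumr_ge0 => r _; apply: sqr_ge0.
pose f := trig_sum P alpha (fun r => (z r)^*%C).
have QE : Q = normc (\sum_(n < T) gamma n * f (s n)%:R).
  have -> : \sum_(n < T) gamma n * f (s n)%:R = Q%:C.
    rewrite /f /trig_sum; under eq_bigr do rewrite mulr_sumr.
    rewrite exchange_big real_complex_sum; apply: eq_bigr => r _.
    by rewrite sqr_normcE mulrC mulr_sumr; apply: eq_bigr => n _; rewrite mulrCA.
  by rewrite /= expr0n addr0 sqrtr_sqr ger0_norm.
have : Q ^+ 2 <= T%:R * (12%:R * (N + q)%:R * Q).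
  rewrite {1}QE; apply: le_trans (cauchy_schwarz_normc _ _ _) _.
  apply: ler_pM; do ?by apply: sumr_ge0 => n _; apply: sqr_ge0.
    rewrite -[T in _ <= T%:R]card_ord -sumr_const; apply: ler_sum => n _.
    by rewrite expr_le1 ?normc_ge0 ?g1.
  have sN' (n : 'I_T) : (s n < N.+1)%N by rewrite ltnS sN.
  have inj : {in predT &, injective (fun n : 'I_T => Ordinal (sN' n))}.
    by move=> n m _ _ /(congr1 val) /= /sinj e; apply: val_inj; apply: e; rewrite inE ltn_ord.
  have := sum_injective_le (g := fun m => normc (f m%:R) ^+ 2) (fun j => sqr_ge0 _) inj.
  move/le_trans; apply; apply: le_trans (large_sieve_dual _ _ q0 a01 sp) _.
  by under eq_bigr do rewrite normcJ_eq.
have [->|] := eqVneq Q 0; first by rewrite !mulr_ge0 ?ler0n.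
rewrite -[Q != 0]/(~~ _) => Qn0; have Qp : 0 < Q by rewrite lt_def Qn0.
have -> : T%:R * (12%:R * (N + q)%:R * Q) = 12%:R * (N + q)%:R * T%:R * Q by ring.
by rewrite expr2 ler_pM2r.
Qed.

Definition farey_point (R : realType) (D : nat) (x : 'I_D.+1 * 'I_D.+1) : R :=
  x.2%:R / x.1%:R.

Definition reduced_fraction (D : nat) (x : 'I_D.+1 * 'I_D.+1) : bool :=
  (x.2 < x.1)%N && coprime x.2 x.1.

(** The difference of two reduced fractions and its distance to 1 are
    nonzero fractions of denominator d d' <= D^2. *)
Lemma farey_spacing (R : realType) (D : nat) (x y : 'I_D.+1 * 'I_D.+1) :
  reduced_fraction x -> reduced_fraction y -> x != y ->
  1 / (D ^ 2)%:R <= `|farey_point R x - farey_point R y| <= 1 - 1 / (D ^ 2)%:R.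
Proof.
case: x y => [d b] [d' b'] /andP[/= bd cb] /andP[/= bd' cb'] ne.
have d0 : (0 < d)%N by apply: leq_ltn_trans bd.
have d'0 : (0 < d')%N by apply: leq_ltn_trans bd'.
have dD : (d * d' <= D ^ 2)%N by rewrite -mulnn leq_mul // -ltnS ltn_ord.
have D0 : (0 < D ^ 2)%N by apply: leq_trans dD; rewrite muln_gt0 d0.
have ne' : (b * d' != b' * d)%N.
  apply: contra ne => /eqP e.
  have dd' : d = d' :> nat.
    apply/eqP; rewrite eqn_dvd; apply/andP; split.
      have : (d %| b * d')%N by rewrite e dvdn_mull.
      by rewrite Gauss_dvdr // coprime_sym.
    have : (d' %| b' * d)%N by rewrite -e dvdn_mull.
    by rewrite Gauss_dvdr // coprime_sym.
  have bb' : b = b' :> nat by apply/eqP; move/eqP: e; rewrite dd' eqn_pmul2r.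
  by apply/eqP; congr (_, _); apply: val_inj.
have dR : 0 < d%:R :> R by rewrite ltr0n.
have d'R : 0 < d'%:R :> R by rewrite ltr0n.
have DR : 0 < (D ^ 2)%:R :> R by rewrite ltr0n.
have le1 : 1 / (D ^ 2)%:R <= 1 / (d%:R * d'%:R) :> R.
  by rewrite !mul1r lef_pV2 ?posrE ?mulr_gt0 // -natrM ler_nat.
have key : 1 / (d%:R * d'%:R) <= `|b%:R / d%:R - b'%:R / d'%:R : R| <= 1 - 1 / (d%:R * d'%:R).
  set u := (d%:R * d'%:R : R); have u0 : 0 < u by rewrite mulr_gt0.
  have -> : b%:R / d%:R - b'%:R / d'%:R = ((b * d')%:R - (b' * d)%:R) / u.
    by rewrite /u !natrM; field; rewrite !gt_eqF.
  have -> : 1 - 1 / u = (u - 1) / u by field; rewrite gt_eqF.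
  rewrite normrM (gtr0_norm (_ : 0 < u^-1)) ?invr_gt0 // !ler_pM2r ?invr_gt0 //.
  have x1 : (b * d' + 1 <= d * d')%N by rewrite addn1 ltn_pmul2r.
  have y1 : (b' * d + 1 <= d * d')%N by rewrite addn1 (mulnC d) ltn_pmul2r.
  move: x1 y1; rewrite -(ler_nat R) -[(b' * d + 1 <= _)%N](ler_nat R) !natrD (natrM _ d) -/u.
  have x0 : 0 <= (b * d')%:R :> R by rewrite ler0n.
  have y0 : 0 <= (b' * d)%:R :> R by rewrite ler0n.
  have : ((b * d')%:R + 1 <= (b' * d)%:R :> R) || ((b' * d)%:R + 1 <= (b * d')%:R :> R).
    by rewrite !natr1 !ler_nat -neq_ltn.
  move: ((b * d')%:R : R) ((b' * d)%:R : R) x0 y0 => x y x0 y0.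
  by case: (ger0P (x - y)) => ? /orP[] ? ? ?; apply/andP; split; lra.
rewrite /farey_point /=; case/andP: key => k1 k2.
by rewrite (le_trans le1 k1) (le_trans k2) // lerD2l lerN2.
Qed.

Lemma farey_large_sieve (R : realType) (D N T : nat) (s : nat -> nat) (gamma : nat -> R[i]) :
  (0 < D)%N ->
  (forall n, n < T -> s n <= N)%N -> {in [pred n | (n < T)%N] &, injective s} ->
  (forall n, (n < T)%N -> normc (gamma n) <= 1) ->
  \sum_(1 <= d < D.+1) \sum_(b < d | coprime b d)
     normc (\sum_(n < T) gamma n * e2pi (b%:R / d%:R * (s n)%:R)) ^+ 2
    <= 12%:R * (N + D ^ 2)%:R * T%:R.
Proof.
move=> D0 sN sinj g1.
have q0 : (0 < D ^ 2)%N by rewrite expn_gt0 D0.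
have a01 (x : 'I_D.+1 * 'I_D.+1) : reduced_fraction x -> 0 <= farey_point R x < 1.
  move=> /andP[lt _]; have x0 : 0 < x.1%:R :> R by rewrite ltr0n (leq_ltn_trans _ lt).
  by rewrite divr_ge0 ?ler0n //= ltr_pdivrMr // mul1r ltr_nat.
apply: le_trans (large_sieve q0 a01 (@farey_spacing R D) sN sinj g1).
pose F d b := normc (\sum_(n < T) gamma n * e2pi (b%:R / d%:R * (s n)%:R)) ^+ 2.
rewrite le_eqVlt; apply/orP; left; apply/eqP.
transitivity (\sum_(d < D.+1) \sum_(b < D.+1 | (b < d)%N && coprime b d) F d b).
  rewrite -(big_mkord xpredT (fun d => \sum_(b < D.+1 | (b < d)%N && coprime b d) F d b)).
  rewrite [RHS](@big_cat_nat _ _ _ 1) //= big_nat1 [X in X + _]big1 ?add0r; last by move=> b; rewrite ltn0.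
  apply: eq_big_nat => d /andP[d1 dD].
  rewrite (big_ord_widen_cond D.+1 (fun b => coprime b d) (F d)) ?(ltnW dD) //.
  by apply: eq_bigl => b; rewrite andbC.
by rewrite pair_big_dep.
Qed.

(** * Fourier expansion of a periodic function along its divisors *)

(** Each b / t with b < t has a unique reduced form, whose denominator
    divides t. *)
Lemma sum_fractions (R : realType) (V : nmodType) (t : nat) (phi : R -> V) : (0 < t)%N ->
  \sum_(b < t) phi (b%:R / t%:R) =
  \sum_(d <- divisors t) \sum_(b < d | coprime b d) phi (b%:R / d%:R).
Proof.
move=> t0.
transitivity (\sum_(d <- divisors t) \sum_(b < t | d == (t %/ gcdn b t)%N) phi (b%:R / t%:R)).
  rewrite (exchange_big_dep predT) //=; apply: eq_bigr => b _.
  rewrite -big_filter filter_pred1_uniq ?divisors_uniq // ?big_seq1 // -dvdn_divisors //.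
  by rewrite dvdn_div // dvdn_gcdr.
rewrite big_seq [RHS]big_seq; apply: eq_bigr => d; rewrite -dvdn_divisors // => dt.
have d0 : (0 < d)%N := dvdn_gt0 t0 dt.
pose e := (t %/ d)%N; have te : t = (d * e)%N by rewrite mulnC divnK.
have e0 : (0 < e)%N by rewrite divn_gt0 // dvdn_leq.
have lt1 (b : 'I_d) : (b * e < t)%N by rewrite te ltn_pmul2r.
have lt2 (b : 'I_t) : (b %/ e < d)%N by rewrite ltn_divLR // -te.
rewrite (reindex_onto (fun b => Ordinal (lt1 b)) (fun b => Ordinal (lt2 b))) /=.
  apply: eq_big => [b|b _]; last first.
    congr phi; rewrite {1}te !natrM -mulf_div divff ?mulr1 // pnatr_eq0 -lt0n //.
  rewrite -val_eqE /= mulnK // eqxx andbT te -muln_gcdl divnMr //.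
  rewrite eqn_div ?dvdn_gcdr ?gcdn_gt0 ?d0 ?orbT //.
  by rewrite -[X in _ == X]muln1 eqn_pmul2l.
move=> b; rewrite eqn_div ?dvdn_gcdr ?gcdn_gt0 ?t0 ?orbT // => /eqP db.
apply: val_inj => /=; rewrite divnK //.
have -> : e = gcdn b t; last exact: dvdn_gcdl.
by apply/eqP; rewrite -(eqn_pmul2l d0) db -te.
Qed.

Lemma sum_residue_class (V : nmodType) (t d : nat) (f : nat -> V) (r : 'I_d) :
  (0 < t)%N -> (d %| t)%N ->
  \sum_(x < t | (x %% d)%N == r) f x = \sum_(y < t %/ d) f (r + d * y)%N.
Proof.
move=> t0 dt; have d0 : (0 < d)%N := dvdn_gt0 t0 dt.
have lt1 (y : 'I_(t %/ d)) : (r + d * y < t)%N.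
  rewrite -[ltnRHS](divnK dt) (mulnC _ d).
  by apply: leq_trans (_ : d * y.+1 <= _)%N; rewrite ?leq_mul2l ?ltn_ord ?orbT // mulnS ltn_add2r.
have lt2 (x : 'I_t) : (x %/ d < t %/ d)%N by rewrite ltn_divLR // divnK.
rewrite (reindex_onto (fun y => Ordinal (lt1 y)) (fun x => Ordinal (lt2 x))) /=.
  apply: eq_bigl => y; rewrite -val_eqE /= (mulnC d) addnC modnMDl modn_small // eqxx.
  by rewrite divnMDl // (divn_small (ltn_ord r)) addn0 eqxx.
by move=> x /eqP xr; apply: val_inj => /=; rewrite -xr addnC mulnC -divn_eq.
Qed.

Lemma normc_sum_seq_sqr (R : realType) (I : Type) (r : seq I) (x : I -> R[i]) :
  normc (\sum_(i <- r) x i) ^+ 2 <= (size r)%:R * \sum_(i <- r) normc (x i) ^+ 2.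
Proof.
case: r => [|i0 r]; first by rewrite !big_nil ComplexField.Normc.normc0 expr0n mulr0.
rewrite !(big_nth i0) !big_mkord.
have := @cauchy_schwarz_normc R _ predT (fun _ : 'I_(size (i0 :: r)) => 1) (fun i => x (nth i0 (i0 :: r) i)).
under eq_bigr do rewrite mul1r.
under [X in _ <= X * _]eq_bigr do rewrite ComplexField.Normc.normc1 expr1n.
by rewrite sumr_const card_ord.
Qed.

Lemma sum_e2pi_sub (R : realType) (d m n : nat) : (0 < d)%N ->
  \sum_(b < d) e2pi (b%:R / d%:R * m%:R : R) * e2pi (- (b%:R / d%:R * n%:R)) =
  if (m == n %[mod d])%N then d%:R else 0.
Proof.
move=> d0; have -> : (m == n %[mod d])%N = (d %| m%:Z - n%:Z)%Z.
  by rewrite -eqz_mod_dvd !modz_nat eqz_nat.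
rewrite -sum_e2pi_div //; apply: eq_bigr => b _; rewrite -e2piD; congr e2pi.
by rewrite rmorphB /= -!pmulrn; ring.
Qed.

Lemma fourier_inversion (R : realType) (t : nat) (f : nat -> R[i]) (m : nat) : (0 < t)%N ->
  (forall x, f (x %% t)%N = f x) ->
  t%:R * f m = \sum_(b < t) (\sum_(x < t) f x * e2pi (- (b%:R / t%:R * x%:R))) *
    e2pi (b%:R / t%:R * m%:R).
Proof.
move=> t0 ft; under eq_bigr do rewrite mulr_suml; rewrite exchange_big /=.
under eq_bigr => x _.
  under eq_bigr do rewrite -mulrA [e2pi (- _) * _]mulrC.
  rewrite -mulr_sumr sum_e2pi_sub //; over.
rewrite (bigD1 (Ordinal (ltn_pmod m t0))) //= modn_mod eqxx ft mulrC big1 ?addr0 // => x xm.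
case: eqP => [e|_]; last by rewrite mulr0.
by case/eqP: xm; apply: val_inj; rewrite /= e modn_small.
Qed.

(** The quantity B_d of the introduction: the part of the large sieve sum
    carried by the reduced fractions of denominator d. *)
Definition reduced_energy (R : realType) (T : nat) (s : nat -> nat)
    (gamma : nat -> R[i]) (d : nat) : R :=
  \sum_(b < d | coprime b d)
    normc (\sum_(n < T) gamma n * e2pi (b%:R / d%:R * (s n)%:R)) ^+ 2.

Lemma reduced_energy_ge0 (R : realType) (T : nat) (s : nat -> nat)
    (gamma : nat -> R[i]) (d : nat) : 0 <= reduced_energy T s gamma d.
Proof. by apply: sumr_ge0 => b _; apply: sqr_ge0. Qed.

(** By Parseval modulo d the sum of squares of the Fourier coefficients at
    multiples of 1 / d is d times the sum of the squares over the d residue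
    classes; each class is a sum of t / d values. *)
Lemma fourier_energy_bound (R : realType) (t d : nat) (f : nat -> R[i]) (w : R) :
  (0 < t)%N -> (d %| t)%N ->
  (forall r, (r < d)%N ->
     normc (\sum_(y < t %/ d) f (r + d * y)%N) ^+ 2 <= (t %/ d)%:R ^+ 2 * w) ->
  \sum_(b < d) normc (\sum_(x < t) f x * e2pi (- (b%:R / d%:R * x%:R))) ^+ 2
    <= t%:R ^+ 2 * w.
Proof.
move=> t0 dt fw; have d0 : (0 < d)%N := dvdn_gt0 t0 dt.
rewrite (@parseval R _ _ _ (fun (b : 'I_d) (x : 'I_t) => e2pi (- (b%:R / d%:R * x%:R)))
   (fun x : 'I_t => Ordinal (ltn_pmod x d0)) d%:R (fun x => f x)); last first.
  move=> x y; have -> : (Ordinal (ltn_pmod x d0) == Ordinal (ltn_pmod y d0)) =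
    (y == x %[mod d])%N by rewrite -val_eqE eq_sym.
  rewrite rmorph_nat -sum_e2pi_sub //; apply: eq_bigr => b _.
  by rewrite conj_e2pi opprK mulrC.
have -> : t%:R ^+ 2 * w = d%:R * \sum_(r < d) ((t %/ d)%:R ^+ 2 * w) :> R.
  by rewrite sumr_const card_ord -[in LHS](divnK dt) natrM -[_ *+ d]mulr_natl; ring.
apply: ler_wpM2l; first by rewrite ler0n.
apply: ler_sum => r _; apply: le_trans (fw r (ltn_ord r)).
rewrite -(sum_residue_class _ _ t0 dt) le_eqVlt; apply/orP; left; apply/eqP.
by congr (normc _ ^+ 2); apply: eq_bigl => x; rewrite -val_eqE.
Qed.

Lemma periodic_sum_bound (R : realType) (t T : nat) (f : nat -> R[i])
    (s : nat -> nat) (gamma : nat -> R[i]) (W : nat -> R) : (0 < t)%N ->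
  (forall x, f (x %% t)%N = f x) ->
  (forall d r, (d %| t)%N -> (r < d)%N ->
     normc (\sum_(y < t %/ d) f (r + d * y)%N) ^+ 2 <= (t %/ d)%:R ^+ 2 * W d) ->
  normc (\sum_(n < T) gamma n * f (s n)) ^+ 2 <=
  (size (divisors t))%:R * \sum_(d <- divisors t) W d * reduced_energy T s gamma d.
Proof.
move=> t0 ft fW; have tR : 0 < t%:R :> R by rewrite ltr0n.
pose G x := \sum_(y < t) f y * e2pi (- (x * y%:R)).
pose A x := \sum_(n < T) gamma n * e2pi (x * (s n)%:R).
have sE : t%:R * \sum_(n < T) gamma n * f (s n) =
    \sum_(d <- divisors t) \sum_(b < d | coprime b d) G (b%:R / d%:R) * A (b%:R / d%:R).
  rewrite -(sum_fractions (fun x => G x * A x)) // mulr_sumr.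
  under eq_bigr do rewrite mulrCA (fourier_inversion _ t0 ft) mulr_sumr.
  rewrite exchange_big /=; apply: eq_bigr => b _; rewrite mulr_sumr.
  by apply: eq_bigr => n _; rewrite mulrCA.
have ntE : normc (t%:R : R[i]) = t%:R.
  by rewrite -(rmorph_nat (real_complex R)) /= expr0n addr0 sqrtr_sqr ger0_norm ?ler0n.
rewrite -(ler_pM2l (exprn_gt0 2 tR)) -{1}ntE -exprMn -ComplexField.Normc.normcM sE.
apply: le_trans (normc_sum_seq_sqr _ _) _; rewrite mulrCA; apply: ler_wpM2l; first by rewrite ler0n.
rewrite mulr_sumr big_seq [leRHS]big_seq; apply: ler_sum => d; rewrite -dvdn_divisors // => dt.
apply: le_trans (cauchy_schwarz_normc _ _ _) _; rewrite mulrA; apply: ler_wpM2r.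
  exact: reduced_energy_ge0.
apply: le_trans (fourier_energy_bound t0 dt (fun r => fW d r dt)).
rewrite [leRHS](bigID (fun b : 'I_d => coprime b d)) /= lerDl.
by apply: sumr_ge0 => b _; apply: sqr_ge0.
Qed.

(** In the block 4^i <= d < 4^(i+1) the factor W d / d is at most 4^(-i) and
    also at most 22 y 2^(-i). The first bound absorbs the term D^2 of the large
    sieve into a geometric sum dominated by its last term, the second turns
    the term N into a convergent geometric series. *)
Lemma block_large_sieve (R : realType) (c N y : R) (B W : nat -> R) :
  0 <= c -> 0 <= N -> 0 <= y -> (forall d, 0 <= B d) -> (forall d, 0 <= W d <= 1) ->
  (forall i d, (d < 4 ^ i.+1)%N -> W d <= 22%:R * 2 ^+ i * y) ->
  (forall D, (0 < D)%N -> \sum_(1 <= d < D.+1) B d <= c * (N + D%:R ^+ 2)) ->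
  forall I, \sum_(1 <= d < 4 ^ I) d%:R^-1 * W d * B d <=
    c * (6%:R * 4%:R ^+ I + 44%:R * (1 - 2 ^- I) * (y * N)).
Proof.
move=> c0 N0 y0 B0 W01 Wi LS; elim=> [|i IH].
  rewrite expn0 big_geq // expr0 invr1 subrr mulr0 mul0r addr0 mulr_ge0 // mulr1 ler0n //.
have le4 : (4 ^ i <= 4 ^ i.+1)%N by rewrite leq_exp2l.
have i4 : (0 < 4 ^ i)%N by rewrite expn_gt0.
rewrite (@big_cat_nat _ _ _ (4 ^ i)) //=.
have R4 : 0 < 4%:R ^+ i :> R by rewrite exprn_gt0 // ltr0n.
have R2 : 0 < 2 ^+ i :> R by rewrite exprn_gt0 // ltr0n.
have E4 : 4%:R ^+ i = 2 ^+ i * 2 ^+ i :> R.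
  by rewrite -exprMn; congr (_ ^+ i); rewrite -natrM.
have block : \sum_(4 ^ i <= d < 4 ^ i.+1) d%:R^-1 * W d * B d <=
    c * (16%:R * 4%:R ^+ i + 22%:R * 2 ^- i * (y * N)).
  pose w := Num.min 1 (22%:R * 2 ^+ i * y).
  have w0 : 0 <= w by rewrite le_min ler01 !mulr_ge0 ?ler0n // exprn_ge0.
  apply: (@le_trans _ _ (\sum_(4 ^ i <= d < 4 ^ i.+1) 4%:R ^- i * w * B d)).
    rewrite big_nat_cond [leRHS]big_nat_cond; apply: ler_sum => d /andP[/andP[d1 d2] _].
    apply: ler_wpM2r => //; apply: ler_pM.
    - by rewrite invr_ge0 ler0n.
    - by have /andP[] := W01 d.
    - rewrite lef_pV2 ?posrE //; last by rewrite ltr0n (leq_trans i4).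
      by rewrite -natrX ler_nat.
    - by rewrite le_min Wi // andbT; have /andP[] := W01 d.
  rewrite -mulr_sumr.
  apply: (@le_trans _ _ (4%:R ^- i * w * (c * (N + (4 ^ i.+1)%:R ^+ 2)))).
    apply: ler_wpM2l; first by rewrite mulr_ge0 // invr_ge0 ltW.
    apply: le_trans (LS (4 ^ i.+1)%N _); last by rewrite expn_gt0.
    rewrite [leRHS](@big_cat_nat _ _ _ (4 ^ i)) //= ?leqW //.
    rewrite [X in _ <= _ + X](@big_cat_nat _ _ _ (4 ^ i.+1)) //=.
    rewrite addrCA lerDl addr_ge0 ?sumr_ge0 //.
  have w1 : w <= 1 by rewrite ge_min lexx.
  have w2 : w <= 22%:R * 2 ^+ i * y by rewrite ge_min lexx orbT.
  rewrite natrX (exprS 4%:R i); set Z := N + _.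
  have -> : 4%:R ^- i * w * (c * Z) = c * (w * Z / 4%:R ^+ i) by ring.
  apply: ler_wpM2l => //; rewrite ler_pdivrMr // /Z.
  have -> : (16%:R * (4%:R ^+ i) + 22%:R * 2 ^- i * (y * N)) * 4%:R ^+ i =
     16%:R * (4%:R ^+ i) ^+ 2 + 22%:R * 2 ^+ i * y * N.
    by rewrite E4; field; rewrite gt_eqF.
  rewrite mulrDr addrC; apply: lerD; last by apply: ler_wpM2r.
  have -> : (4%:R * 4%:R ^+ i) ^+ 2 = 16%:R * (4%:R ^+ i) ^+ 2 :> R by ring.
  by rewrite ler_piMl // mulr_ge0 ?ler0n ?sqr_ge0.
apply: le_trans (lerD IH block) _; rewrite -mulrDr; apply: ler_wpM2l => //.
have yN : 0 <= y * N by rewrite mulr_ge0.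
have -> : 2 ^- i.+1 = 2 ^- i / 2 :> R by rewrite exprS invfM mulrC.
rewrite (exprS 4%:R i); move: (4%:R ^+ i) (2 ^- i) R4 yN => u v u0 yN.
have : 0 <= u by apply: ltW.
lra.
Qed.

(** * The contribution of one prime *)

Lemma Fp_nat_expr_eq1 (p l m : nat) : prime p ->
  ((l%:R : 'F_p) ^+ m == 1) = (l ^ m == 1 %[mod p])%N.
Proof. by move=> pp; rewrite -natrX -val_eqE /= val_Fp_nat // Fp_cast. Qed.

(** Lets the theory of primitive roots of unity describe the powers of l
    modulo p. *)
Lemma mul_order_primitive (l p : nat) : prime p -> ~~ (p %| l)%N ->
  (mul_order l p).-primitive_root (l%:R : 'F_p).
Proof.
move=> pp pl; have t0 : (0 < mul_order l p)%N by apply: order_gt0.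
have lt : (l%:R : 'F_p) ^+ mul_order l p = 1.
  by apply/eqP; rewrite Fp_nat_expr_eq1 // -mul_order_dvdn.
have [m gm mt] := prim_order_exists t0 lt.
suff -> : mul_order l p = m by [].
apply/eqP; rewrite eqn_dvd mt andbT mul_order_dvdn // -Fp_nat_expr_eq1 //.
by rewrite (prim_expr_order gm).
Qed.

Lemma mul_order_dvd_pred (l p : nat) : prime p -> ~~ (p %| l)%N ->
  (mul_order l p %| p.-1)%N.
Proof.
move=> pp pl; rewrite mul_order_dvdn // -totient_prime //.
by apply/eqP/Euler_exp_totient; rewrite coprime_sym prime_coprime.
Qed.

Lemma expsum_addchar (R : realType) (l T p m : nat) (s : nat -> nat) (gamma : nat -> R[i]) :
  prime p ->
  expsum l s gamma T p m%:Z =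
  \sum_(n < T) gamma n.+1 * addchar R (m%:R * (l%:R : 'F_p) ^+ s n.+1).
Proof.
move=> pp; rewrite /expsum big_add1 big_mkord; apply: eq_bigr => n _; congr (_ * _).
by rewrite -[in RHS]natrX -[in RHS]natrM addchar_nat // natrM natrX -pmulrn.
Qed.

Lemma max_expsum2_nat (R : realType) (l T p : nat) (s : nat -> nat) (gamma : nat -> R[i]) :
  prime p -> exists2 m : nat, (m%:R : 'F_p) != 0 &
    max_expsum2 l s gamma T p = normc (expsum l s gamma T p m%:Z) ^+ 2.
Proof.
move=> pp; have [a ap ->] := max_expsum2_attained l s gamma T pp.
have p0 := prime_gt0 pp.
have rE : (a %% p)%Z = `|(a %% p)%Z|%N by rewrite gez0_abs // modz_ge0 // eqz_nat -lt0n.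
exists `|(a %% p)%Z|%N; last by rewrite -rE expsum_modz.
rewrite -(dvdn_pcharf (pchar_Fp pp)) -prime_coprime // coprime_sym.
by move: ap; rewrite /coprimez -gcdz_modl rE.
Qed.

Lemma max_expsum2_trivial (R : realType) (l T p : nat) (s : nat -> nat) (gamma : nat -> R[i]) :
  prime p -> (forall n, (1 <= n)%N -> normc (gamma n) <= 1) ->
  max_expsum2 l s gamma T p <= T%:R ^+ 2.
Proof.
move=> pp g1; have [m _ ->] := max_expsum2_nat l T s gamma pp.
rewrite lerXn2r ?nnegrE ?normc_ge0 ?ler0n // expsum_addchar //.
apply: le_trans (normc_sum_le _ _ _) _.
rewrite -[T in leRHS]card_ord -sumr_const; apply: ler_sum => n _.
by rewrite ComplexField.Normc.normcM normc_addchar mulr1 g1.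
Qed.

(** A majorant of the squared ratio of a subgroup sum to its length. It is
    constant on the blocks 4^i <= d < 4^(i+1), where 2^i stands for the square
    root of d. *)
Definition saving (R : realType) (y : R) (d : nat) : R :=
  Num.min 1 (22%:R * 2 ^+ trunc_log 4 d * y).

Lemma saving_itv (R : realType) (y : R) (d : nat) : 0 <= y -> 0 <= saving y d <= 1.
Proof.
move=> y0; rewrite ge_min lexx /= andbT le_min ler01 /= !mulr_ge0 ?ler0n //.
Qed.

Lemma saving_le (R : realType) (y : R) (i d : nat) : 0 <= y -> (d < 4 ^ i.+1)%N ->
  saving y d <= 22%:R * 2 ^+ i * y.
Proof.
move=> y0 di; rewrite ge_min; apply/orP; right; apply: ler_wpM2r => //.
apply: ler_wpM2l; first by rewrite ler0n.
rewrite ler_weXn2l ?ler1n //.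
have [->|d0] := posnP d; first by rewrite trunc_log0.
rewrite -ltnS -(ltn_exp2l (m := 4)) // (leq_ltn_trans _ di) //.
by apply: trunc_logP.
Qed.

(** With v = |S / h|^2 <= 1 and h = t / d, the subgroup bound reads
    v^4 <= 11^6 p d^3 / t^3 <= 11^6 y^7 d^3, and v^6 <= v^4, y^7 <= y^6; now
    take sixth roots. *)
Lemma subgroup_saving (R : realType) (p t d : nat) (X Delta y : R) (a g : 'F_p) :
  prime p -> t.-primitive_root g -> (d %| t)%N -> a != 0 ->
  0 <= y <= 1 -> p%:R <= X -> 0 < Delta < t%:R -> X <= y ^+ 7 * Delta ^+ 3 ->
  normc (\sum_(i < t %/ d) addchar R (a * (g ^+ d) ^+ i)) ^+ 2 <=
  (t %/ d)%:R ^+ 2 * saving y d.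
Proof.
move=> pp gt dt a0 /andP[y0 y1] pX /andP[D0 Dt] XD.
have t0 := prim_order_gt0 gt; have d0 := dvdn_gt0 t0 dt.
set h := (t %/ d)%N; have th : t = (h * d)%N by rewrite divnK.
have h0 : (0 < h)%N by rewrite divn_gt0 // dvdn_leq.
have gh : h.-primitive_root (g ^+ d).
  have -> : d = (t %/ h)%N by rewrite th mulKn.
  by apply: dvdn_prim_root => //; rewrite th dvdn_mulr.
have := primitive_sum_bound R pp gh a0; set S := normc _ => S8.
have S0 : 0 <= S by apply: normc_ge0.
have Sh : S <= h%:R.
  apply: le_trans (normc_sum_le _ _ _) _; under eq_bigr do rewrite normc_addchar.
  by rewrite sumr_const card_ord.
have hR : 0 < h%:R :> R by rewrite ltr0n.
rewrite /saving minr_pMr ?sqr_ge0 // le_min mulr1 lerXn2r ?nnegrE ?ler0n //=.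
set w := _ * y; have w0 : 0 <= w by rewrite !mulr_ge0 ?ler0n ?exprn_ge0.
rewrite -(@ler_pXn2r _ 6) ?nnegrE ?sqr_ge0 ?mulr_ge0 ?sqr_ge0 //.
have -> : (S ^+ 2) ^+ 6 = S ^+ 8 * S ^+ 4 by rewrite -exprM -exprD.
apply: (@le_trans _ _ (11%:R ^+ 6 * p%:R * h%:R ^+ 5 * h%:R ^+ 4)).
  by apply: ler_pM => //; rewrite ?exprn_ge0 // lerXn2r ?nnegrE ?ler0n.
have -> : 11%:R ^+ 6 * p%:R * h%:R ^+ 5 * h%:R ^+ 4 = h%:R ^+ 9 * (11%:R ^+ 6 * p%:R) :> R by ring.
rewrite exprMn -exprM (exprD _ 9 3) -mulrA ler_pM2l ?exprn_gt0 //.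
have -> : w ^+ 6 = 11%:R ^+ 6 * ((4 ^ (trunc_log 4 d).+1)%:R ^+ 3 * y ^+ 6).
  have -> : (4 ^ (trunc_log 4 d).+1)%:R = 4%:R * (2 ^+ trunc_log 4 d) ^+ 2 :> R.
    rewrite natrX (exprS 4%:R); congr (_ * _); rewrite (exprAC 2 _ 2); congr (_ ^+ _).
    by rewrite -natrX.
  by rewrite /w; ring.
rewrite mulrCA ler_pM2l ?exprn_gt0 ?ltr0n // mulrA -exprMn -natrM.
apply: le_trans pX (le_trans XD _).
rewrite mulrC; apply: ler_pM; rewrite ?exprn_ge0 //; first exact: ltW.
  rewrite lerXn2r ?nnegrE ?ler0n ?(ltW D0) //; apply: le_trans (ltW Dt) _.
  rewrite th ler_nat leq_mul2l ltnW ?orbT //.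
  by have /andP[] := @trunc_log_bounds 4 d isT d0.
by rewrite exprS ler_piMl // exprn_ge0.
Qed.

Lemma tau_gt0 (n : nat) : (0 < n)%N -> (0 < tau n)%N.
Proof.
move=> n0; have : 1%N \in divisors n by rewrite -dvdn_divisors ?dvd1n.
by rewrite /tau; case: (divisors n).
Qed.

(** The factor size (divisors t) lost in [periodic_sum_bound] is paid by
    the weight 1 / tau(p - 1), because t divides p - 1. *)
Lemma max_expsum2_le (R : realType) (l T p : nat) (s : nat -> nat) (gamma : nat -> R[i])
    (X Delta y : R) :
  prime p -> ~~ (p %| l)%N -> 0 <= y <= 1 -> p%:R <= X ->
  0 < Delta < (mul_order l p)%:R -> X <= y ^+ 7 * Delta ^+ 3 ->
  1 / (tau p.-1)%:R * max_expsum2 l s gamma T p <=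
  \sum_(d <- divisors p.-1) saving y d *
     reduced_energy T (fun n => s n.+1) (fun n => gamma n.+1) d.
Proof.
move=> pp pl y01 pX Dt XD; have gt := mul_order_primitive pp pl.
have y0 : 0 <= y by case/andP: y01.
have t0 := prim_order_gt0 gt; set t := mul_order l p in gt t0 Dt.
have p1 : (0 < p.-1)%N by rewrite -subn1 subn_gt0 prime_gt1.
have tp : (t %| p.-1)%N := mul_order_dvd_pred pp pl.
have sub : {subset divisors t <= divisors p.-1}.
  by move=> d; rewrite -!dvdn_divisors // => dt; apply: dvdn_trans tp.
have tau0 : 0 < (tau p.-1)%:R :> R by rewrite ltr0n tau_gt0.
have [m m0 ->] := max_expsum2_nat l T s gamma pp.
rewrite mul1r mulrC ler_pdivrMr // expsum_addchar //.
pose f x := addchar R (m%:R * (l%:R : 'F_p) ^+ x).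
have ft x : f (x %% t)%N = f x by rewrite /f (prim_expr_mod gt).
have := @periodic_sum_bound R t T f (fun n => s n.+1) (fun n => gamma n.+1) (saving y) t0 ft.
set Z := normc _ ^+ 2; have -> : Z = normc (\sum_(n < T) gamma n.+1 * f (s n.+1)) ^+ 2 by [].
move=> per; apply: le_trans (per _) _ => [d r dt rd|].
  under eq_bigr do rewrite /f exprD mulrA exprM.
  apply: (subgroup_saving pp gt dt _ y01 pX Dt XD).
  by rewrite mulf_neq0 // expf_neq0 // (prim_root_eq0 gt) -lt0n.
have W0 d : 0 <= saving y d * reduced_energy T (fun n => s n.+1) (fun n => gamma n.+1) d.
  by apply: mulr_ge0; [case/andP: (saving_itv d y0)|apply: reduced_energy_ge0].
rewrite mulrC; apply: ler_pM; rewrite ?sumr_ge0 ?ler0n //; last first.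
  by rewrite ler_nat uniq_leq_size // divisors_uniq.
rewrite [leRHS](bigID (fun d => d \in divisors t)) /= -[leLHS]addr0.
apply: lerD; last by apply: sumr_ge0.
rewrite -[leRHS]big_filter; rewrite le_eqVlt; apply/orP; left; apply/eqP; apply: perm_big.
apply: uniq_perm; rewrite ?filter_uniq ?divisors_uniq // => d.
by rewrite mem_filter; case: (boolP (_ \in divisors t)) => // /sub ->.
Qed.

Lemma count_shifted_multiples (r : seq nat) (K d : nat) : (0 < d)%N -> uniq r ->
  (forall p, p \in r -> 1 < p <= K)%N ->
  (count (fun p => d %| p.-1)%N r <= K %/ d)%N.
Proof.
move=> d0 ur rK; rewrite -size_filter -(size_map (fun p => p.-1 %/ d)%N) -(size_iota 1 (K %/ d)).
apply: uniq_leq_size.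
  rewrite map_inj_in_uniq ?filter_uniq // => p q; rewrite !mem_filter => /andP[dp pr] /andP[dq qr] e.
  have : p.-1 = q.-1 by rewrite -(divnK dp) e divnK.
  by have := rK _ pr; have := rK _ qr; lia.
move=> k /mapP[p]; rewrite mem_filter => /andP[dp pr] ->.
have /andP[p1 pK] := rK _ pr; rewrite mem_iota add1n ltnS divn_gt0 // leq_div2r ?andbT; last by lia.
by apply: dvdn_leq => //; lia.
Qed.

(** Exchange the two sums: d occurs once for each p congruent to 1 modulo
    d. *)
Lemma sum_divisors_pred_le (R : realType) (r : seq nat) (K : nat) (g : nat -> R) : uniq r ->
  (forall p, p \in r -> 1 < p <= K)%N -> (forall d, 0 <= g d) ->
  \sum_(p <- r) \sum_(d <- divisors p.-1) g d <= \sum_(1 <= d < K.+1) (K %/ d)%:R * g d.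
Proof.
move=> ur rK g0.
rewrite big_seq (eq_bigr (fun p => \sum_(1 <= d < K.+1 | (d %| p.-1)%N) g d)); last first.
  move=> p pr; have /andP[p1 pK] := rK _ pr; have p0 : (0 < p.-1)%N by lia.
  rewrite -[RHS]big_filter; apply: perm_big; apply: uniq_perm; rewrite ?divisors_uniq //.
    by rewrite filter_uniq // iota_uniq.
  move=> d; rewrite mem_filter -dvdn_divisors // mem_index_iota.
  case: (boolP (d %| p.-1)%N) => //= dp; rewrite (dvdn_gt0 p0 dp) /= ltnS.
  by apply/esym; apply: leq_trans (dvdn_leq p0 dp) _; lia.
rewrite -big_seq (exchange_big_dep predT) //= big_nat_cond [leRHS]big_nat_cond.
apply: ler_sum => d /andP[/andP[d0 _] _].
rewrite big_const_seq iter_addr_0 -[_ *+ count _ _]mulr_natl; apply: ler_wpM2r => //.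
by rewrite ler_nat count_shifted_multiples.
Qed.

(** * Summation over the primes *)

Local Open Scope classical_set_scope.
Local Open Scope complex_scope.
Local Open Scope ring_scope.

(** The case L = 1 of the theorem without its third term, with
    y = X^(1/7) Delta^(-3/7). *)
Lemma Eset_sum_bound (R : realType) (l T : nat) (X Delta y : R)
    (s : nat -> nat) (gamma : nat -> R[i]) (r : seq nat) :
  1 <= X -> 0 <= y <= 1 -> 0 < Delta -> X <= y ^+ 7 * Delta ^+ 3 ->
  (forall m n, (1 <= m)%N -> (m < n)%N -> (s m < s n)%N) ->
  (forall n, (1 <= n)%N -> ComplexField.Normc.normc (gamma n) <= 1) ->
  uniq r -> (forall p, p \in r -> Eset l Delta X p) ->
  \sum_(p <- r) 1 / (tau p.-1)%:R * max_expsum2 l s gamma T p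
    <= 528%:R * (X + (s T)%:R * y) * X * T%:R.
Proof.
move=> X1 y01 D0 XD smono g1 ur rE.
have y0 : 0 <= y by case/andP: y01.
have X0 : 0 < X by apply: lt_le_trans X1.
pose K := Num.truncn X.
have K1 : (0 < K)%N by rewrite truncn_gt0.
have KX : K%:R <= X by rewrite truncn_le // ltW.
pose B := reduced_energy T (fun n => s n.+1) (fun n => gamma n.+1).
have B0 d : 0 <= B d by apply: reduced_energy_ge0.
have W01 d : 0 <= saving y d <= 1 by apply: saving_itv.
have W0 d : 0 <= saving y d by case/andP: (W01 d).
apply: (@le_trans _ _ (\sum_(p <- r) \sum_(d <- divisors p.-1) saving y d * B d)).
  rewrite big_seq [leRHS]big_seq; apply: ler_sum => p /rE [pp pX pl Dt].
  by apply: (@max_expsum2_le R l T p s gamma X Delta y) => //; rewrite D0.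
apply: (@le_trans _ _ (\sum_(1 <= d < K.+1) (K %/ d)%:R * (saving y d * B d))).
  apply: sum_divisors_pred_le => // [p /rE [pp pX _ _]|d]; last by rewrite mulr_ge0.
  by rewrite prime_gt1 //= truncn_ge_nat // ltW.
pose I := (trunc_log 4 K).+1.
have KI : (K < 4 ^ I)%N by apply: trunc_log_ltn.
have I4 : (4 ^ I <= 4 * K)%N by rewrite expnS leq_mul2l trunc_logP.
apply: (@le_trans _ _ (X * \sum_(1 <= d < 4 ^ I) d%:R^-1 * saving y d * B d)).
  rewrite mulr_sumr [leRHS](@big_cat_nat _ _ _ K.+1) //= -[leLHS]addr0; apply: lerD; last first.
    by apply: sumr_ge0 => d _; rewrite !mulr_ge0 ?invr_ge0 ?ler0n // ltW.
  rewrite big_nat_cond [leRHS]big_nat_cond; apply: ler_sum => d /andP[/andP[d1 _] _].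
  have -> : X * (d%:R^-1 * saving y d * B d) = X / d%:R * (saving y d * B d) by ring.
  apply: ler_wpM2r; first by rewrite mulr_ge0.
  rewrite ler_pdivlMr ?ltr0n //; apply: le_trans KX.
  by rewrite -natrM ler_nat leq_divM.
have LS D : (0 < D)%N -> \sum_(1 <= d < D.+1) B d <= 12%:R * T%:R * ((s T)%:R + D%:R ^+ 2).
  move=> D1; have sT n : (n < T)%N -> (s n.+1 <= s T)%N.
    by rewrite leq_eqVlt => /predU1P[->//|nT]; apply/ltnW/smono.
  have inj : {in [pred n | (n < T)%N] &, injective (fun n => s n.+1)}.
    move=> m n _ _ /= e; case: (ltngtP m n) => // lt.
      by have := smono m.+1 n.+1 isT lt; rewrite e ltnn.
    by have := smono n.+1 m.+1 isT lt; rewrite e ltnn.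
  have := @farey_large_sieve R D (s T) T (fun n => s n.+1) (fun n => gamma n.+1) D1 sT inj (fun n _ => g1 n.+1 isT).
  by rewrite natrD natrX mulrAC.
have c0 : 0 <= 12%:R * T%:R :> R by rewrite mulr_ge0 ?ler0n.
have := block_large_sieve c0 (ler0n R (s T)) y0 B0 W01 (fun i d => saving_le y0) LS I.
move=> bd; apply: le_trans (ler_wpM2l (ltW X0) bd) _.
have -> : 528%:R * (X + (s T)%:R * y) * X * T%:R =
    X * (12%:R * T%:R * (44%:R * X + 44%:R * (y * (s T)%:R))) by ring.
apply: ler_wpM2l; first exact: ltW.
apply: ler_wpM2l => //; apply: lerD.
  have : 4%:R ^+ I <= 4%:R * X :> R.
    apply: (@le_trans _ _ ((4 * K)%:R)); first by rewrite -natrX ler_nat.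
    by rewrite natrM ler_wpM2l ?ler0n.
  by move=> le; lra.
apply: ler_wpM2r; first by rewrite mulr_ge0 ?ler0n.
by rewrite -[leRHS]mulr1 ler_wpM2l ?ler0n // gerDl oppr_le0 invr_ge0 exprn_ge0.
Qed.

Lemma Eset_sum_trivial (R : realType) (l T : nat) (X Delta : R)
    (s : nat -> nat) (gamma : nat -> R[i]) (r : seq nat) :
  0 <= X -> (forall n, (1 <= n)%N -> ComplexField.Normc.normc (gamma n) <= 1) ->
  uniq r -> (forall p, p \in r -> Eset l Delta X p) ->
  \sum_(p <- r) 1 / (tau p.-1)%:R * max_expsum2 l s gamma T p <= X * T%:R ^+ 2.
Proof.
move=> X0 g1 ur rE; pose K := Num.truncn X.
apply: (@le_trans _ _ (\sum_(p <- r) T%:R ^+ 2)).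
  rewrite big_seq [leRHS]big_seq; apply: ler_sum => p /rE [pp pX pl Dt].
  have := max_expsum2_trivial l T s pp g1.
  apply: le_trans; rewrite ler_piMl //.
    have [m _ ->] := max_expsum2_nat l T s gamma pp.
    exact: sqr_ge0.
  have tau0 : (0 < tau p.-1)%N by rewrite tau_gt0 // -subn1 subn_gt0 prime_gt1.
  by rewrite ler_pdivrMr ?mul1r ?ler1n ?ltr0n.
rewrite big_const_seq count_predT iter_addr_0 -[_ *+ size r]mulr_natl; apply: ler_wpM2r; first exact: sqr_ge0.
apply: (@le_trans _ _ K%:R); last by rewrite truncn_le.
rewrite ler_nat -(size_iota 1 K); apply: uniq_leq_size => // p /rE [pp pX _ _].
by rewrite mem_iota prime_gt0 //= add1n ltnS truncn_ge_nat.
Qed.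

Lemma powR_exprn (R : realType) (x a : R) (n : nat) : (x `^ a) ^+ n = x `^ (a * n%:R).
Proof. by rewrite powRrM powR_mulrn ?powR_ge0. Qed.

Theorem theorem1 (R : realType) (lambda : nat) (hlambda : (2 <= lambda)%N) :
  exists2 C : R, 0 < C &
  exists (X0 : R) (T0 : nat),
  forall (X : R) (T : nat), X0 <= X -> (T0 <= T)%N ->
  forall Delta : R, X `^ (1 / 3) < Delta ->
  forall s : nat -> nat,
    (forall n, (1 <= n)%N -> (0 < s n)%N) ->
    (forall m n, (1 <= m)%N -> (m < n)%N -> (s m < s n)%N) ->
  forall gamma : nat -> R[i],
    (forall n, (1 <= n)%N -> ComplexField.Normc.normc (gamma n) <= 1) ->
  forall L : R, 0 < L ->
    \sum_(p \in Eset lambda Delta X)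
       1 / (tau p.-1)%:R * max_expsum2 lambda s gamma T p
    <= C * (X + (s T)%:R * X `^ (1 / 7) * Delta `^ (- (3 / 7)) * L
              + T%:R * L `^ (- (7 / 4))) * X * T%:R.
Proof.
exists 528%:R => //; exists 1, 0%N => X T X1 _ Delta XDelta s _ smono gamma g1 L L0.
have X0 : 0 < X by apply: lt_le_trans X1.
have D0 : 0 < Delta by apply: le_lt_trans XDelta; apply: powR_ge0.
rewrite fsbig_finite; last exact: finite_Eset.
set r := fset_set _ => /=.
have ur : uniq r by exact: fset_uniq.
have rE p : p \in r -> Eset lambda Delta X p.
  rewrite /r in_fset_set; [by move=> /set_mem|exact: finite_Eset].
pose y := X `^ (1 / 7) * Delta `^ (- (3 / 7)).
have y0 : 0 < y by rewrite mulr_gt0 ?powR_gt0.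
have y7 : y ^+ 7 * Delta ^+ 3 = X.
  rewrite /y exprMn !powR_exprn divfK ?pnatr_eq0 // powRr1 ?(ltW X0) // mulNr divfK ?pnatr_eq0 //.
  by rewrite powRN powR_mulrn ?(ltW D0) // divfK // expf_neq0 // gt_eqF.
(* The hypothesis X^(1/3) < Delta says exactly that y < 1. *)
have y1 : y <= 1.
  have : X <= Delta ^+ 3.
    have -> : X = (X `^ (1 / 3)) ^+ 3.
      by rewrite powR_exprn divfK ?pnatr_eq0 // powRr1 // ltW.
    by rewrite lerXn2r ?nnegrE ?powR_ge0 // ltW.
  rewrite -{1}y7 -[leRHS]mul1r ler_pM2r ?exprn_gt0 //.
  by rewrite expr_le1 // ltW.
have P0 : 0 <= (s T)%:R * y * L.
  by apply: mulr_ge0; [apply: mulr_ge0; [exact: ler0n | exact: ltW] | exact: ltW].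
have P1 : 0 <= T%:R * L `^ (- (7 / 4)) by rewrite mulr_ge0 ?ler0n ?powR_ge0.
rewrite -[(s T)%:R * X `^ _ * _]mulrA -/y.
have [L1|L1] := leP 1 L.
  apply: le_trans (@Eset_sum_bound R lambda T X Delta y s gamma r X1 _ D0 _ smono g1 ur rE) _.
  - by rewrite (ltW y0).
  - by rewrite y7.
  apply: ler_wpM2r; first by rewrite ler0n.
  apply: ler_wpM2r; first exact: ltW.
  apply: ler_wpM2l; first by rewrite ler0n.
  rewrite -[leLHS]addr0; apply: lerD => //; apply: lerD => //.
  by rewrite ler_peMr // mulr_ge0 ?ler0n // ltW.
apply: le_trans (@Eset_sum_trivial R lambda T X Delta s gamma r (ltW X0) g1 ur rE) _.
have L2 : 1 <= L `^ (- (7 / 4)).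
  rewrite powRN -[1 in leLHS]invr1 lef_pV2 ?posrE ?powR_gt0 //.
  have one : (1 : R) `^ (7 / 4) = 1 by rewrite powR1.
  by rewrite -[leRHS]one ge0_ler_powR ?nnegrE ?divr_ge0 ?ler0n // ltW.
rewrite expr2 mulrA mulrAC; apply: ler_wpM2r; first by rewrite ler0n.
rewrite [leRHS]mulrC -[leLHS]mulrC mulrC; apply: ler_wpM2l; first exact: ltW.
apply: (@le_trans _ _ (T%:R * L `^ (- (7 / 4)))); first by rewrite ler_peMr ?ler0n.
have : 0 <= X + (s T)%:R * y * L by rewrite addr_ge0 // ltW.
by move: (X + _) (T%:R * _) P1 => u v v0 u0; lra.
Qed.
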